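(* Fix integers $g\ge 1$, $s,m\ge 1$, $E\ge 1$, $N$ with $ms\mid N$, a clipping constant $C>0$ and a noise parameter $\sigma>0$, and let $\mathcal{M}$ be the mechanism described in the context (with an arbitrary update algorithm $\mathcal{A}$ and a sampling procedure ${\tt Sample}_{s,m}$ as described there). Let $q_E$ be the distribution on $\mathcal{C}$ defined in the context. Let $c^{\tt U}>0$ and $u_{c^{\tt U}}$ satisfy $$1\ \ge\ u_{c^{\tt U}}\ \ge \sum_{c\in\mathcal{C}:\,c<c^{\tt U}} q_E(c).$$ Define $\hat f^{\tt U}_{c^{\tt U}}(\alpha)=u_{c^{\tt U}}+(1-u_{c^{\tt U}})\,G_{c^{\tt U}/\sigma}(\alpha)$ for $\alpha\in[0,1]$ and $f^{\tt U}_{c^{\tt U}}=\min\{\hat f^{\tt U}_{c^{\tt U}},(\hat f^{\tt U}_{c^{\tt U}})^{-1}\}^{**}$, which equals $$f^{\tt U}_{c^{\tt U}}(\alpha)=\begin{cases} u_{c^{\tt U}}+(1-u_{c^{\tt U}})G_{c^{\tt U}/\sigma}(\alpha), & \alpha\in[0,\beta_0],\\ \beta_0+\beta_1-\alpha, & \alpha\in[\beta_0,\beta_1],\\ G_{c^{\tt U}/\sigma}\!\left(\frac{\alpha-u_{c^{\tt U}}}{1-u_{c^{\tt U}}}\right), & \alpha\in[\beta_1,1],\end{cases}$$ where $\beta_0=1-\Phi\!\left(\frac{c^{\tt U}}{2\sigma}-\frac{\sigma}{c^{\tt U}}\ln(1-u_{c^{\tt U}})\right)$ and $\beta_1=u_{c^{\tt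 U}}+(1-u_{c^{\tt U}})\left(1-\Phi\!\left(\frac{c^{\tt U}}{2\sigma}+\frac{\sigma}{c^{\tt U}}\ln(1-u_{c^{\tt U}})\right)\right)$. If $h$ is a trade-off function such that $\mathcal{M}$ is $h$-DP for all pairs of data sets $d,d'$ with $\max\{|d\setminus d'|,|d'\setminus d|\}\le g$ and $N=|d\cap d'|+g$, then $$h\le f^{\tt U}_{c^{\tt U}}\le \hat f^{\tt U}_{c^{\tt U}}.$$ Moreover, $f^{\tt U}_{c^{\tt U}}$ is a symmetric trade-off function.
   Context: Trade-off functions: for distributions $P,Q$ on a common space, $T(P,Q)(\alpha)=\inf_\phi\{1-\mathbb{E}_Q[\phi]:\mathbb{E}_P[\phi]\le\alpha\}$, $\alpha\in[0,1]$, the infimum over measurable $\phi$ with values in $[0,1]$. A function $f:[0,1]\to[0,1]$ is a trade-off function if it is convex, continuous, non-increasing and $f(\alpha)\le 1-\alpha$. A mechanism $\mathcal{M}$ is $f$-DP for a family of pairs $(d,d')$ if $T(\mathcal{M}(d),\mathcal{M}(d'))\ge f$ for all pairs in the family. For a trade-off function $h$, $h^{-1}(\alpha)=\inf\{t\in[0,1]:h(t)\le\alpha\}$; $h$ is symmetric if $h^{-1}=h$. $h^{*}(y)=\sup_x\{yx-h(x)\}$ is the convex conjugate and $h^{**}$ the double conjugate. $G_\mu(\alpha)=\Phi(\Phi^{-1}(1-\alpha)-\mu)$, with $\Phi$ the standard normal CDF. Mechanism $\mathcal{M}$: input a data set $d=\{\xi_1,\dots,\xi_N\}$. For each epoch $e=1,\dots,E$: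 draw a uniformly random permutation $\pi^e$ of $\{1,\dots,N\}$ and re-index $\xi_i\leftarrow\xi_{\pi^e(i)}$; a sampling procedure ${\tt Sample}_{s,m}$ outputs index sets $S^e_{b,h}\subseteq\{1,\dots,N\}$, $b=1,\dots,N/(ms)$, $h=1,\dots,m$, with $|S^e_{b,h}|=s$ and, for each $b$, $S^e_{b,1},\dots,S^e_{b,m}$ pairwise disjoint with union $S^e_b$ of size $ms$. In round $b$: compute $a_h\leftarrow\mathcal{A}(w,\{\xi_i\}_{i\in S^e_{b,h}})$ for each $h$, where $\mathcal{A}$ is an arbitrary (possibly randomized) algorithm depending only on the current local model $w$ and these samples; set $U=\sum_{h=1}^m[a_h]_C$ with $[x]_C=x/\max\{1,\|x\|/C\}$; set $\bar U=U+\mathcal{N}(0,(2C\sigma)^2\mathbf{I})$; release $\bar U/m$ and update $w\leftarrow w-\eta\,\bar U/m$ (step sizes $\eta$ arbitrary; $w$ may also be overwritten by externally received global models). $\mathcal{M}(d)$ is the sequence of released values. Distribution $q_E$: let $\mathcal{C}=\{\sqrt{\sum_{k=1}^g c_kk^2}: c_k\in\mathbb{N}\}$. Then $q_E(c)$ is the probability, over the permutations $\pi^e$ and the outputs $\{S^e_{b,h}\}$ of ${\tt Sample}_{s,m}$ for $e=1,\dots,E$, that $c^2=\sum_{k=1}^g c_kk^2$ where $c_k=\#\{(b,e):L_{b,e}=k\}$ and $L_{b,e}=|\{h:\pi^e(S^e_{b,h})\cap\{1,\dots,g\}\ne\emptyset\}|$. Standing assumptions of the paper's privacy analysis: the difference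 between $|d|$ and $|d'|$ is assumed to cause negligible leakage, so both are treated as indexed by $\{1,\dots,N\}$ with an index-to-sample mapping agreeing on $d\cap d'$; and the hypothesis-testing adversary is a strong adversary who is given this mapping, all randomness used by $\mathcal{A}$ (including model overwrites), and the realized instance of the sampling procedure. *)

(* Defs.v *)
From HB Require Import structures.
From mathcomp Require Import all_boot all_order all_algebra all_fingroup.
From mathcomp Require Import all_classical all_reals all_analysis.

Set Implicit Arguments.
Unset Strict Implicit.
Unset Printing Implicit Defensive.

Import Order.TTheory GRing.Theory Num.Theory.
Import numFieldNormedType.Exports.

Local Open Scope classical_set_scope.
Local Open Scope ring_scope.

(* Trade-off functions (functions [0,1] -> [0,1], represented as R -> R and  *)
(* only ever evaluated on [0,1]).                                            *)
Section TradeOff.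
Variable R : realType.

Definition in01 (x : R) : Prop := 0 <= x /\ x <= 1.

Definition is_tradeoff (f : R -> R) : Prop :=
  [/\ (forall x, in01 x -> in01 (f x)),
      (forall x y t, in01 x -> in01 y -> in01 t ->
         f (t * x + (1 - t) * y) <= t * f x + (1 - t) * f y),
      {within `[0, 1], continuous f},
      (forall x y, in01 x -> in01 y -> x <= y -> f y <= f x) &
      (forall x, in01 x -> f x <= 1 - x)].

(* h^{-1}(alpha) = inf {t in [0,1] : h t <= alpha}; the infimum of the empty
   set is taken to be 1 (the top of [0,1]). *)
Definition tinv (h : R -> R) (a : R) : R :=
  inf ([set t | in01 t /\ h t <= a] `|` [set 1]).

Definition tsymmetric (h : R -> R) : Prop :=
  forall a, in01 a -> tinv h a = h a.

Definition conj (h : R -> R) (y : R) : R :=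
  sup [set y * x - h x | x in [set x | in01 x]].

Definition biconj (h : R -> R) (a : R) : R :=
  sup [set y * a - conj h y | y in [set: R]].

Definition fle (f g : R -> R) : Prop := forall a, in01 a -> f a <= g a.

Definition Phi (x : R) : R := fine (normal_prob 0 1 `]-oo, x]).

Definition Phiinv (p : R) : R := inf [set x | p <= Phi x].

Definition G (mu a : R) : R :=
  if a <= 0 then 1 else if 1 <= a then 0 else Phi (Phiinv (1 - a) - mu).

Definition tradeoffT dO (Omega : measurableType dO) (P : probability Omega R)
  dV (V : measurableType dV) (X Y : Omega -> V) (a : R) : R :=
  inf [set 1 - fine (\int[P]_w (phi (Y w))%:E) |
       phi in [set phi : V -> R |
         [/\ measurable_fun setT phi,
             (forall v, 0 <= phi v <= 1) &
             fine (\int[P]_w (phi (X w))%:E) <= a]]].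

Definition is_fDP dO (Omega : measurableType dO) (P : probability Omega R)
  dV (V : measurableType dV) (f : R -> R) (X Y : Omega -> V) : Prop :=
  fle f (tradeoffT P X Y).

End TradeOff.

Definition discr (T : Type) : Type := T.
HB.instance Definition _ (T : choiceType) := Choice.on (discr T).
HB.instance Definition _ (T : pointedType) := Pointed.on (discr T).
HB.instance Definition _ (T : pointedType) :=
  @isMeasurable.Build default_measure_display (discr T) discrete_measurable
    discrete_measurable0 discrete_measurableC discrete_measurableU.

Section Mechanism.
Variables (N E B m : nat).

(* realized instance: for each epoch e, the permutation pi^e and the output
   S^e_{b,h} of the sampling procedure *)
Definition Inst : Type :=
  {ffun 'I_E -> {perm 'I_N} * {ffun 'I_B -> {ffun 'I_m -> {set 'I_N}}}}.
HB.instance Definition _ := Finite.on Inst.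

Definition inst0 : Inst := [ffun _ => ((1%g : {perm 'I_N}), [ffun _ => [ffun _ => (finset.set0 : {set 'I_N})]])].
HB.instance Definition _ := isPointed.Build Inst inst0.

Definition iperm (i : Inst) (e : 'I_E) : {perm 'I_N} := (i e).1.
Definition iset (i : Inst) (e : 'I_E) (b : 'I_B) (h : 'I_m) : {set 'I_N} :=
  (i e).2 b h.

Definition sample_ok (s : nat) (i : Inst) : Prop :=
  forall e b, (forall h, #|iset i e b h| = s) /\
    (forall h h', h != h' -> iset i e b h :&: iset i e b h' = finset.set0).

(* L_{b,e}: number of subsets h whose image pi^e(S^e_{b,h}) meets the
   first g indices {1,...,g} (= {0,...,g-1} zero-based) *)
Definition Lbe (g : nat) (i : Inst) (e : 'I_E) (b : 'I_B) : nat :=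
  #|[set h : 'I_m | [exists j in iset i e b h, (iperm i e j < g)%N]]|.

Definition ck (g : nat) (i : Inst) (k : nat) : nat :=
  #|[set be : 'I_B * 'I_E | Lbe g i be.2 be.1 == k]|.

Definition csq (g : nat) (i : Inst) : nat :=
  (\sum_(1 <= k < g.+1) ck g i k * k ^ 2)%N.

Variable R : realType.
Variable D : nat.

Local Notation vec := (D.-tuple R).
Definition vadd (x y : vec) : vec := [tuple tnth x k + tnth y k | k < D].
Definition vscale (a : R) (x : vec) : vec := [tuple a * tnth x k | k < D].
Definition v0 : vec := [tuple 0 | k < D].
Definition vnorm (x : vec) : R := Num.sqrt (\sum_(k < D) tnth x k ^+ 2).
Definition clip (C : R) (x : vec) : vec :=
  vscale (Num.max 1 (vnorm x / C))^-1 x.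

Variable Xi : Type.

(* One round (e,b): returns (new local model, released value).
   A : local model -> samples of the subset -> update vector.
   ow e b : optional externally received global model overwriting w.
   z : the standard normal noise vector of the round. *)
Definition round_step (C sigma : R) (A : vec -> seq Xi -> vec)
  (d : 'I_N -> Xi) (i : Inst) (eta : 'I_E -> 'I_B -> R)
  (ow : 'I_E -> 'I_B -> option vec) (e : 'I_E) (b : 'I_B) (z : 'I_D -> R)
  (w : vec) : vec * vec :=
  let w1 := if ow e b is Some v then v else w in
  let a h := A w1 [seq d (iperm i e j) | j <- enum (iset i e b h)] in
  let U := \big[vadd/v0]_(h < m) clip C (a h) in
  let Ubar := vadd U [tuple 2 * C * sigma * z k | k < D] in
  let rel := vscale (m%:R)^-1 Ubar in
  (vadd w1 (vscale (- eta e b) rel), rel).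

Fixpoint run (C sigma : R) (A : vec -> seq Xi -> vec) (d : 'I_N -> Xi)
  (i : Inst) (eta : 'I_E -> 'I_B -> R) (ow : 'I_E -> 'I_B -> option vec)
  (z : 'I_E -> 'I_B -> 'I_D -> R) (rs : seq ('I_E * 'I_B)) (w : vec)
  : seq vec :=
  if rs is r :: rs' then
    let p := round_step C sigma A d i eta ow r.1 r.2 (z r.1 r.2) w in
    p.2 :: run C sigma A d i eta ow z rs' p.1
  else [::].

Definition rounds : seq ('I_E * 'I_B) :=
  [seq (e, b) | e <- enum 'I_E, b <- enum 'I_B].

Definition Out := E.-tuple (B.-tuple vec).

Definition released (C sigma : R) (A : vec -> seq Xi -> vec) (w0 : vec)
  (eta : 'I_E -> 'I_B -> R) (ow : 'I_E -> 'I_B -> option vec)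
  (d : 'I_N -> Xi) (i : Inst) (z : 'I_E -> 'I_B -> 'I_D -> R) : Out :=
  let s := run C sigma A d i eta ow z rounds w0 in
  [tuple [tuple nth v0 s (e * B + b) | b < B] | e < E].

(* the view of the strong adversary: realized instance and released values *)
Definition View := (discr Inst * Out)%type.

Definition mview (Omega : Type) (C sigma : R) (A : vec -> seq Xi -> vec)
  (w0 : vec) (eta : 'I_E -> 'I_B -> R) (ow : 'I_E -> 'I_B -> option vec)
  (I : Omega -> Inst) (Z : Omega -> 'I_E -> 'I_B -> 'I_D -> R)
  (d : 'I_N -> Xi) : Omega -> View :=
  fun w => (I w : discr Inst, released C sigma A w0 eta ow d (I w) (Z w)).

End Mechanism.

Definition Cset (R : realType) (g : nat) : set R :=
  [set c | exists cs : nat -> nat,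
     c = Num.sqrt ((\sum_(1 <= k < g.+1) cs k * k ^ 2)%N%:R)].

Definition qE (R : realType) N E B m dO (Omega : measurableType dO)
  (P : probability Omega R) (I : Omega -> Inst N E B m) (g : nat) (c : R)
  : \bar R :=
  P [set w | c ^+ 2 = (csq g (I w))%:R].

Definition fU_formula (R : realType) (cU sigma u a : R) : R :=
  let beta0 := 1 - Phi (cU / (2 * sigma) - sigma / cU * ln (1 - u)) in
  let beta1 := u + (1 - u) *
                 (1 - Phi (cU / (2 * sigma) + sigma / cU * ln (1 - u))) in
  if a <= beta0 then u + (1 - u) * G (cU / sigma) a
  else if a <= beta1 then beta0 + beta1 - a
  else G (cU / sigma) ((a - u) / (1 - u)).

(* Main.v *)
(** Let the update algorithm answer [C e_1] when one of its samples is the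
    marked value [xi1] and [- C e_1] otherwise, and let [d] be marked on the
    first [g] indices and [d'] nowhere.  The two runs then differ in round
    [(b,e)] by [2 C L_{b,e}] along [e_1], so that, given the instance, the
    [L]-weighted sum of the released first coordinates tests a Gaussian shift
    [c / sigma] with [c^2 = sum L^2].  Testing at a common level, and only when
    [c >= cU], bounds the trade-off function of the mechanism by
    [u + (1 - u) G_{cU / sigma}]; complementing the test for the swapped pair
    bounds it by the inverse.

    The biconjugate of the minimum of a function and its inverse is symmetric,
    since its affine minorants are closed under reflection.  It is computed
    from the tangents of [fhat]: by Neyman-Pearson those at points where the
    slope is at most -1 lie below [fhat], and so do their reflections; the
    two families meet in the line of slope -1. *)

Require Import Defs.
From HB Require Import structures.
From mathcomp Require Import all_boot all_order all_algebra all_fingroup.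
From mathcomp Require Import all_classical all_reals all_analysis.
From mathcomp Require Import ring lra measurable_realfun.

Set Implicit Arguments.
Unset Strict Implicit.
Unset Printing Implicit Defensive.

Import Order.TTheory GRing.Theory Num.Theory.
Import numFieldNormedType.Exports.
Local Open Scope classical_set_scope.
Local Open Scope ring_scope.

(** * The Gaussian distribution *)

Definition image_measure d d' (T : measurableType d) (T' : measurableType d')
  (R : realType) (m : {measure set T -> \bar R}) (f : T -> T')
  (mf : measurable_fun setT f) : {measure set T' -> \bar R} :=
  measure_function_pushforward__canonical__measure_function_Measure m mf.

Section Gaussian.
Variable R : realType.
Local Notation mu := (@lebesgue_measure R).
Local Notation std := (normal_prob (0 : R) 1).

(** A Gaussian law is expressed through preimages of the standard one under this map; s = 0 then
    gives the point mass at m. *)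
Definition affine (m s : R) (z : measurableTypeR R) : measurableTypeR R :=
  m + s * z.

Lemma measurable_affine (m s : R) : measurable_fun setT (affine m s).
Proof.
by apply: measurable_funD => //; exact: mulrl_measurable.
Qed.

Lemma normal_pdf_affine (m s z : R) : 0 < s ->
  normal_pdf m s (affine m s z) = s^-1 * normal_pdf 0 1 z.
Proof.
move=> s0; rewrite /affine !normal_pdfE ?gt_eqF// /normal_peak /normal_fun.
rewrite mulrA; congr (_ * expR _).
  rewrite -mulrnAr expr1n sqrtrM ?sqr_ge0// sqrtr_sqr gtr0_norm//.
  by rewrite mul1r invfM.
by field; rewrite gt_eqF.
Qed.

(** Uniqueness of Lebesgue measure: s times the image measure assigns each half-open interval its
    length. *)
Lemma lebesgue_measure_affine (m s : R) (A : set R) : 0 < s -> measurable A ->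
  (s%:E * mu (affine m s @^-1` A))%E = mu A.
Proof.
move=> s0 mA; have s0' : 0 <= s by exact: ltW.
have := @lebesgue_measure_unique R
  (mscale (NngNum s0') (image_measure mu (measurable_affine m s))).
rewrite /mscale/= => /(_ _ _ mA) ->//.
move=> _ [[a b]] _ <-/=; rewrite /mscale/= /pushforward/=.
have -> : affine m s @^-1` `]a, b]%classic = `](a - m) / s, (b - m) / s]%classic.
  apply/seteqP; split => z /=; rewrite /affine !in_itv/= ltr_pdivrMr// ler_pdivlMr//.
    by move=> /andP[? ?]; apply/andP; split; lra.
  by move=> /andP[? ?]; apply/andP; split; lra.
rewrite !lebesgue_measure_itv/= !lte_fin ltr_pM2r ?invr_gt0// ltrD2r.
case: ifP => _; last by rewrite mule0.
by rewrite -!EFinD -EFinM; congr EFin; field; rewrite gt_eqF.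
Qed.

Lemma normal_prob_affine (m s : R) (A : set R) : 0 < s -> measurable A ->
  normal_prob m s A = std (affine m s @^-1` A).
Proof.
move=> s0 mA; have mf := measurable_affine m s.
have s0' : 0 <= s by exact: ltW.
rewrite /normal_prob.
transitivity (\int[mscale (NngNum s0') (image_measure mu mf)]_(x in A) (normal_pdf m s x)%:E)%E.
  apply: eq_measure_integral => B mB _; rewrite /mscale/= /pushforward.
  exact/esym/lebesgue_measure_affine.
have mp : measurable_fun A (fun x : measurableTypeR R => (normal_pdf m s x)%:E).
  by apply/measurable_EFinP; apply: measurable_funTS; exact: measurable_normal_pdf.
have mpos x : x \in A -> (0 <= (normal_pdf m s x)%:E)%E.
  by move=> _; rewrite lee_fin normal_pdf_ge0.
rewrite ge0_integral_mscale//.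
- rewrite ge0_integral_pushforward//= -ge0_integralZl//.
  + apply: eq_integral => z _ /=.
    by rewrite normal_pdf_affine// -EFinM mulrA divff ?gt_eqF// mul1r.
  + rewrite -[X in measurable X]setTI; exact: mf.
  + apply/measurable_EFinP => /=.
    apply: measurable_funTS; apply: measurableT_comp; first exact: measurable_normal_pdf.
    exact: mf.
  + by move=> z _; rewrite lee_fin normal_pdf_ge0.
- by move=> x Ax; apply: mpos; rewrite inE.
Qed.

(** The Radon-Nikodym derivative agrees almost everywhere with the explicit density, since both have
    the same integrals over measurable sets. *)
Lemma ge0_integral_normal_prob (m s : R) (f : R -> \bar R) :
  measurable_fun setT f -> (forall x, 0 <= f x)%E ->
  (\int[normal_prob m s]_x f x = \int[mu]_x (f x * (normal_pdf m s x)%:E))%E.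
Proof.
move=> mf f0.
have dom := @normal_prob_dominates R m s.
rewrite -(Radon_Nikodym_SigmaFinite.change_of_variables dom)//=.
apply: ge0_ae_eq_integral => //.
- apply: emeasurable_funM => //; apply: (measurable_int mu).
  exact: Radon_Nikodym_SigmaFinite.f_integrable.
- apply: emeasurable_funM => //; apply/measurable_EFinP.
  exact: measurable_normal_pdf.
- by move=> x _; rewrite mule_ge0// Radon_Nikodym_SigmaFinite.f_ge0.
- by move=> x _; rewrite mule_ge0// lee_fin normal_pdf_ge0.
- apply: ae_eqe_mul2l => /=.
  apply: integral_ae_eq => //=.
  + exact: Radon_Nikodym_SigmaFinite.f_integrable.
  + by apply/measurable_EFinP; exact: measurable_normal_pdf.
  + move=> E _ mE; rewrite -Radon_Nikodym_SigmaFinite.f_integral//.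
Qed.

(* Completing the square. *)
Lemma normal_pdf_convolution (s L x y : R) : 0 < s -> 0 < L ->
  normal_pdf 0 1 x * normal_pdf (s * x) L y =
  normal_pdf 0 (Num.sqrt (s ^+ 2 + L ^+ 2)) y *
  normal_pdf (s * y / (s ^+ 2 + L ^+ 2)) (L / Num.sqrt (s ^+ 2 + L ^+ 2)) x.
Proof.
move=> s0 L0; set r := Num.sqrt _.
have sL0 : 0 < s ^+ 2 + L ^+ 2 by rewrite addr_gt0// exprn_gt0.
have r0 : 0 < r by rewrite sqrtr_gt0.
have r2 : r ^+ 2 = s ^+ 2 + L ^+ 2 by rewrite sqr_sqrtr// ltW.
rewrite !normal_pdfE ?gt_eqF ?divr_gt0// /normal_peak /normal_fun.
rewrite mulrACA [RHS]mulrACA -!expRD; congr (_ * expR _).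
  rewrite -!invfM; congr (_^-1).
  rewrite -[LHS]sqrtrM ?mulrn_wge0 ?mulr_ge0 ?sqr_ge0 ?pi_ge0 ?(ltW r0)//.
  rewrite -[RHS]sqrtrM ?mulrn_wge0 ?mulr_ge0 ?sqr_ge0 ?pi_ge0 ?(ltW r0)//.
  by congr Num.sqrt; field; rewrite gt_eqF.
rewrite expr_div_n r2; field.
by rewrite !gt_eqF.
Qed.

Lemma measurable_normal_pdf_mean (L s : R) : 0 < L ->
  measurable_fun setT (fun z : measurableTypeR R * measurableTypeR R =>
    normal_pdf (s * z.1) L z.2).
Proof.
move=> L0; rewrite (_ : (fun _ => _) = (normal_pdf 0 L) \o
   (fun z : measurableTypeR R * measurableTypeR R => z.2 - s * z.1)); last first.
  by apply/funext => z /=; rewrite !normal_pdfE ?gt_eqF// /normal_fun subr0.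
apply: measurableT_comp; first exact: measurable_normal_pdf.
by apply: measurable_funB => //; apply: measurable_funM.
Qed.

Local Open Scope ereal_scope.

(** The law of s X + L Z for independent standard normals. By Tonelli and completing the square, the
    integral over x is that of a Gaussian density. Zero weights have no density and are treated
    apart. *)
Lemma normal_prob_convolution (s L : R) (A : set R) :
  (0 <= s)%R -> (0 <= L)%R -> measurable A ->
  \int[std]_x std (affine (s * x) L @^-1` A) =
  std (affine 0 (Num.sqrt (s ^+ 2 + L ^+ 2)) @^-1` A).
Proof.
move=> s0 L0 mA; have [->|Ln0] := eqVneq L 0%R.
  rewrite expr0n/= addr0 sqrtr_sqr ger0_norm//.
  rewrite -[RHS]mul1e -integral_cst//; last first.
    by rewrite -[X in measurable X]setTI; exact: measurable_affine.
  rewrite [RHS]integral_mkcond; apply: eq_integral => x _.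
  rewrite patchE; case: ifPn => [|/negP]; rewrite inE/= /affine add0r => Asx.
    rewrite (_ : _ @^-1` _ = setT) ?probability_setT//.
    by apply/seteqP; split => // z _ /=; rewrite mul0r addr0.
  rewrite (_ : _ @^-1` _ = set0) ?measure0//.
  by apply/seteqP; split => // z /=; rewrite mul0r addr0 => /Asx.
have {Ln0}L0 : (0 < L)%R by rewrite lt_neqAle eq_sym Ln0.
have [->|sn0] := eqVneq s 0%R.
  under eq_integral do rewrite mul0r.
  rewrite integral_cst// expr0n/= add0r sqrtr_sqr gtr0_norm//.
  by rewrite probability_setT mule1.
have {sn0}s0 : (0 < s)%R by rewrite lt_neqAle eq_sym sn0.
have sL0 : (0 < s ^+ 2 + L ^+ 2)%R by rewrite addr_gt0// exprn_gt0.
rewrite -normal_prob_affine ?sqrtr_gt0//.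
under eq_integral do rewrite -normal_prob_affine//.
pose f (z : measurableTypeR R * measurableTypeR R) :=
  (\1_A z.2 * normal_pdf (s * z.1) L z.2 * normal_pdf 0 1 z.1)%:E.
have mf : measurable_fun setT f.
  apply/measurable_EFinP/measurable_funM; last first.
    by apply: measurableT_comp; first exact: measurable_normal_pdf.
  apply: measurable_funM; last exact: measurable_normal_pdf_mean.
  by apply: measurableT_comp.
have f0 z : 0 <= f z by rewrite lee_fin !mulr_ge0// normal_pdf_ge0.
pose g (z : measurableTypeR R * measurableTypeR R) :=
  (\1_A z.2 * normal_pdf (s * z.1) L z.2)%:E.
have mg : measurable_fun setT g.
  apply/measurable_EFinP/measurable_funM; last exact: measurable_normal_pdf_mean.
  by apply: measurableT_comp.
have g0 z : 0 <= g z by rewrite lee_fin !mulr_ge0// normal_pdf_ge0.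
have gE x : normal_prob (s * x) L A = \int[mu]_y g (x, y).
  rewrite /normal_prob integral_mkcond; apply: eq_integral => y _.
  by rewrite patchE /g/= indicE; case: ifPn => _; rewrite ?mul1r ?mul0r.
transitivity (\int[mu]_x \int[mu]_y f (x, y)).
  under eq_integral do rewrite gE.
  rewrite ge0_integral_normal_prob//; last 2 first.
    exact: (measurable_fun_fubini_tonelli_F g).
    by move=> x; exact: integral_ge0.
  apply: eq_integral => x _.
  rewrite -ge0_integralZr//; last by rewrite lee_fin normal_pdf_ge0.
  by apply: measurableT_comp => //; exact: pair1_measurable.
rewrite fubini_tonelli//.
rewrite /normal_prob [RHS]integral_mkcond; apply: eq_integral => y _.
rewrite patchE /f/= indicE; case: ifPn => _; last first.
  by under eq_integral do rewrite !mul0r; rewrite integral0.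
under eq_integral do rewrite mul1r mulrC normal_pdf_convolution// EFinM.
rewrite ge0_integralZl//; last 3 first.
- by apply/measurable_EFinP; exact: measurable_normal_pdf.
- by move=> x _; rewrite lee_fin normal_pdf_ge0.
- by rewrite lee_fin normal_pdf_ge0.
by rewrite integral_normal_pdf mule1.
Qed.

Local Close Scope ereal_scope.

Lemma fin_num_std (A : set R) : measurable A -> std A \is a fin_num.
Proof. by move=> mA; exact: fin_num_measure. Qed.

End Gaussian.

(** * The standard normal distribution function *)

Section GaussianCDF.
Variable R : realType.
Local Notation mu := (@lebesgue_measure R).
Local Notation std := (normal_prob (0 : R) 1).

Lemma is_derive_Phi (x : R) : is_derive x 1 (@Phi R) (normal_pdf 0 1 x).
Proof.
have cf : {for x, continuous (normal_pdf (0 : R) 1)}.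
  by apply: continuous_normal_pdf; rewrite oner_neq0.
have fi : (@lebesgue_measure R).-integrable [set` Interval -oo%O (BRight (x + 1))]
    (EFin \o normal_pdf (0 : R) 1).
  by apply: (integrableS _ _ (@subsetT _ _)) => //; exact: integrable_normal_pdf.
have xx : x < x + 1 by rewrite ltrDl.
have [|dF F'E] := continuous_FTC1 xx fi _ cf; first by rewrite ltNyr.
by split; [exact: dF|rewrite -derive1E; exact: F'E].
Qed.

Lemma normal_pdf_gt0 (x : R) : 0 < normal_pdf 0 1 x.
Proof.
rewrite normal_pdfE ?oner_neq0// mulr_gt0 ?normal_peak_gt0 ?oner_neq0//.
exact: expR_gt0.
Qed.

Lemma continuous_Phi : continuous (@Phi R).
Proof.
move=> x; apply: differentiable_continuous; apply/derivable1_diffP.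
by have [] := is_derive_Phi x.
Qed.

Lemma MVT_derive (f df : R -> R) (a b : R) :
  (forall x : R, is_derive x (1 : R) f (df x)) -> a < b ->
  exists c, [/\ a < c, c < b & f b - f a = df c * (b - a)].
Proof.
move=> fdf ab.
have fc : {within `[a, b], continuous f}.
  apply: continuous_subspaceT => x; apply: differentiable_continuous.
  by apply/derivable1_diffP; have [] := fdf x.
have [c] := MVT ab (fun x _ => fdf x) fc.
by rewrite in_itv/= => /andP[ac cb] E; exists c.
Qed.

Lemma ltr_Phi (x y : R) : (Phi x < Phi y) = (x < y).
Proof.
have H (a b : R) : a < b -> Phi a < Phi b.
  move=> xy; have [c [_ _ E]] := MVT_derive is_derive_Phi xy.
  by rewrite -subr_gt0 E mulr_gt0 ?subr_gt0// normal_pdf_gt0.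
have [xy|xy|->] := ltgtP x y; last by rewrite ltxx.
  exact: H.
by apply/negbTE; rewrite -leNgt; exact/ltW/H.
Qed.

Lemma ler_Phi (x y : R) : (Phi x <= Phi y) = (x <= y).
Proof. by rewrite !leNgt ltr_Phi. Qed.

Lemma Phi_ge0 (x : R) : 0 <= Phi x.
Proof. exact: fine_ge0. Qed.

Lemma Phi_le1 (x : R) : Phi x <= 1.
Proof.
rewrite -lee_fin /Phi fineK ?fin_num_std//; exact: probability_le1.
Qed.

Lemma Phi_gt0 (x : R) : 0 < Phi x.
Proof.
by apply: (le_lt_trans (Phi_ge0 (x - 1))); rewrite ltr_Phi ltrBlDr ltrDl.
Qed.

Lemma Phi_lt1 (x : R) : Phi x < 1.
Proof. by apply: (lt_le_trans _ (Phi_le1 (x + 1))); rewrite ltr_Phi ltrDl. Qed.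

Lemma Phi_small (e : R) : 0 < e -> exists x : R, Phi x < e /\ 1 - e < Phi (- x).
Proof.
move=> e0.
pose X : measurableTypeR R -> R := idfun.
pose X' : {RV std >-> R} := HB.pack X
  (@isMeasurableFun.Build _ _ _ _ X (@measurable_id _ _ setT)).
have H0 : @Phi R @ -oo --> (0 : R) by apply/fine_cvg; exact: (cvg_cdfNy0 X').
have H1 : @Phi R @ +oo --> (1 : R) by apply/fine_cvg; exact: (cvg_cdfy1 X').
have /cvgrPdist_lt/(_ _ e0) [M0 [_ HM0]] := H0.
have /cvgrPdist_lt/(_ _ e0) [M1 [_ HM1]] := H1.
exists (Num.min (M0 - 1) (- (M1 + 1))); split.
  have /HM0 : Num.min (M0 - 1) (- (M1 + 1)) < M0 by rewrite gt_min; apply/orP; left; lra.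
  by rewrite sub0r normrN ger0_norm// Phi_ge0.
have /HM1 : M1 < - Num.min (M0 - 1) (- (M1 + 1)).
  by rewrite ltrNr gt_min; apply/orP; right; lra.
by rewrite ger0_norm ?subr_ge0 ?Phi_le1//; lra.
Qed.

(** The derivative of [Phi y + Phi (- y)] vanishes because the density is even; the tails identify
    the constant as 1. *)
Lemma PhiN (x : R) : Phi (- x) = 1 - Phi x.
Proof.
pose f (y : R) := Phi y + Phi (- y).
have df (y : R) : is_derive y (1 : R) f 0.
  have dN : is_derive y (1 : R) (fun y : R => - y) (- 1) by exact: is_deriveN.
  have dP : is_derive (- y) (1:R) (@Phi R) (normal_pdf 0 1 (- y)) by exact: is_derive_Phi.
  have dc := @is_derive1_comp R (@Phi R) (fun y : R => - y) y _ _ dP dN.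
  have d1 := is_derive_Phi y.
  have d := is_deriveD d1 dc.
  apply: (@is_derive_eq _ _ _ _ _ _ _ _ d).
  rewrite !normal_pdfE ?oner_neq0// /normal_fun !subr0 sqrrN.
  by rewrite mulrN1 subrr.
have fc (y z : R) : f y = f z by exact: is_derive_0_is_cst.
have f1 : f x = 1.
  apply/eqP/negPn/negP => fn1.
  have e0 : 0 < `|f x - 1| by rewrite normr_gt0 subr_eq0.
  have [z []] := Phi_small e0; have := Phi_le1 (- z); have := Phi_ge0 z.
  by rewrite (fc x z) -/(f z); case: (ger0P (f z - 1)); rewrite /f => ? ? ? ? ?; lra.
rewrite -f1 /f; lra.
Qed.

Lemma Phi_onto (p : R) : 0 < p -> p < 1 -> exists x, Phi x = p.
Proof.
move=> p0 p1.
have [x [x1 _]] := Phi_small p0.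
have p1' : 0 < 1 - p by rewrite subr_gt0.
have [y [_ y1]] := Phi_small p1'.
rewrite subKr in y1.
have xy : x <= - y by rewrite -ler_Phi; lra.
have [||z _ <-] := @IVT R (@Phi R) x (- y) p xy; last by exists z.
- by apply: continuous_subspaceT => ?; exact: continuous_Phi.
- by rewrite ge_min le_max; apply/andP; split; apply/orP; [left|right]; exact: ltW.
Qed.

Lemma PhiinvK (x : R) : Phiinv (Phi x) = x.
Proof.
rewrite /Phiinv (_ : [set _ | _] = `[x, +oo[%classic); first exact: inf_itv.
by apply/seteqP; split => y /=; rewrite in_itv/= andbT ler_Phi.
Qed.

End GaussianCDF.

(** * Biconjugates and symmetrization *)

Section Biconjugate.
Variables (R : realType) (M : R -> R).
Hypothesis M01 : forall x, in01 x -> in01 (M x).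

(* [conj], the constructor of [/\], is shadowed by the convex conjugate. *)
Lemma in01I (x : R) : 0 <= x -> x <= 1 -> in01 x.
Proof. by []. Qed.

Lemma in01_0 : in01 (0 : R). Proof. by split; rewrite ?ler01. Qed.
Lemma in01_1 : in01 (1 : R). Proof. by split; rewrite ?ler01. Qed.

Lemma conj_ge (y x : R) : in01 x -> y * x - M x <= conj M y.
Proof.
move=> x01; apply: ub_le_sup; last by exists x.
exists `|y| => _ [z [z0 z1] <-]; have [Mz _] := M01 (in01I z0 z1).
rewrite lerBlDr (le_trans (ler_norm _))// normrM (ger0_norm z0).
by rewrite (le_trans (ler_piMr _ _))// lerDl.
Qed.

Lemma conj_le (y b : R) : (forall x, in01 x -> y * x - M x <= b) -> conj M y <= b.
Proof.
move=> H; apply: ge_sup; first by exists (y * 0 - M 0); exists 0 => //; exact: in01_0.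
by move=> _ [x x01 <-]; exact: H.
Qed.

Lemma biconj_ge (a y : R) : in01 a -> y * a - conj M y <= biconj M a.
Proof.
move=> a01; apply: ub_le_sup; last by exists y.
by exists (M a) => _ [z _ <-]; have := conj_ge z a01; lra.
Qed.

Lemma biconj_le (a b : R) : (forall y, y * a - conj M y <= b) -> biconj M a <= b.
Proof.
move=> H; apply: ge_sup; first by exists (0 * a - conj M 0); exists 0.
by move=> _ [y _ <-]; exact: H.
Qed.

Lemma biconj_le_self (a : R) : in01 a -> biconj M a <= M a.
Proof. by move=> a01; apply: biconj_le => y; have := conj_ge y a01; lra. Qed.

Lemma biconj_ge_line (a b k : R) : in01 a ->
  (forall x, in01 x -> b - k * x <= M x) -> b - k * a <= biconj M a.
Proof.
move=> a01 H; apply: le_trans (biconj_ge (- k) a01).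
have : conj M (- k) <= - b by apply: conj_le => x /H; lra.
lra.
Qed.

Lemma biconj_convex (x y t : R) : in01 x -> in01 y -> in01 t ->
  biconj M (t * x + (1 - t) * y) <= t * biconj M x + (1 - t) * biconj M y.
Proof.
move=> x01 y01 [t0 t1]; apply: biconj_le => z.
have := biconj_ge z x01; have := biconj_ge z y01; nra.
Qed.

Lemma biconj_ge0 (a : R) : in01 a -> 0 <= biconj M a.
Proof.
move=> a01; rewrite -[X in X <= _](_ : 0 - 0 * a = 0); last by rewrite mul0r subrr.
by apply: biconj_ge_line => // x /M01[]; rewrite mul0r subrr.
Qed.

Lemma biconj_in01 (a : R) : in01 a -> in01 (biconj M a).
Proof.
move=> a01; split; first exact: biconj_ge0.
by apply: le_trans (biconj_le_self a01) _; have [] := M01 a01.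
Qed.

Hypothesis M1 : M 1 = 0.

Lemma biconj1 : biconj M 1 = 0.
Proof.
by apply/eqP; rewrite eq_le biconj_ge0 ?in01_1// andbT -M1 biconj_le_self//; exact: in01_1.
Qed.

(** Convexity on [x, 1], for a nonnegative function that vanishes at 1. *)
Lemma biconj_nonincreasing (x y : R) : in01 x -> in01 y -> x <= y ->
  biconj M y <= biconj M x.
Proof.
move=> x01 y01 xy.
have [x1|x1] := eqVneq x 1.
  by have -> : y = x by case: y01 => _; lra.
have [x0 x1'] := x01; have [y0 y1] := y01.
have x1'' : 0 < 1 - x by rewrite subr_gt0 lt_neqAle x1.
pose t := (1 - y) / (1 - x).
have t01 : in01 t by split; rewrite /t ?divr_ge0 ?ler_pdivrMr//; lra.
have -> : y = t * x + (1 - t) * 1 by rewrite /t; field; rewrite gt_eqF.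
apply: (le_trans (biconj_convex x01 in01_1 t01)).
rewrite biconj1 mulr0 addr0.
by have := biconj_ge0 x01; case: t01; nra.
Qed.

Hypothesis M0 : 1 <= biconj M 0.

Lemma biconj0 : biconj M 0 = 1.
Proof. by apply/eqP; rewrite eq_le M0 andbT; case: (biconj_in01 in01_0). Qed.

(** Continuity at 0 comes from an affine minorant that nearly attains the value 1 there; at x > 0
    from convexity on [0, q], which bounds the drop from p to q by (q - p) / q. *)
Lemma biconj_eps_delta (x e : R) : in01 x -> 0 < e -> exists2 d, 0 < d &
  forall y, in01 y -> `|x - y| < d -> `|biconj M x - biconj M y| < e.
Proof.
move=> x01 e0; have [x0|x0] := eqVneq x 0.
  have : 1 - e / 2 < biconj M 0 by rewrite biconj0; lra.
  move=> /(sup_gt _) [|_ [z _ <-] Hz].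
    by exists (0 * 0 - conj M 0); exists 0.
  exists (e / (2 * (`|z| + 1))).
    by rewrite divr_gt0// mulr_gt0// ltr_wpDl.
  move=> y y01; rewrite x0 sub0r normrN biconj0; have [y0 y1] := y01.
  rewrite (ger0_norm y0) ltr_pdivlMr; last by rewrite mulr_gt0// ltr_wpDl.
  move=> Hy; have [_ Fy1] := biconj_in01 y01.
  rewrite ger0_norm ?subr_ge0//.
  have Fy := biconj_ge z y01.
  have : - (`|z| * y) <= z * y by rewrite -mulNr ler_wpM2r// lerNnormlW.
  by nra.
have {}x0 : 0 < x by rewrite lt_neqAle eq_sym x0; case: x01.
exists (e * x); first by rewrite mulr_gt0.
have key p q : in01 p -> in01 q -> p <= q -> x <= q -> `|q - p| < e * x ->
    `|biconj M p - biconj M q| < e.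
  move=> p01 q01 pq xq; have q0 : 0 < q by exact: lt_le_trans xq.
  rewrite !ger0_norm ?subr_ge0//; last exact: biconj_nonincreasing.
  pose t := (q - p) / q => qp.
  have tq : t * q = q - p by rewrite /t mulfVK// gt_eqF.
  have t01 : in01 t.
    by split; rewrite /t ?divr_ge0 ?ler_pdivrMr//; case: p01; case: q01; lra.
  have := biconj_convex in01_0 q01 t01.
  have -> : t * 0 + (1 - t) * q = p by rewrite mulr0 add0r mulrBl tq; lra.
  rewrite biconj0; have [Fq0 Fq1] := biconj_in01 q01; have [t0 t1] := t01.
  have : t < e by rewrite /t ltr_pdivrMr//; nra.
  nra.
move=> y y01 xy; have [le_xy|le_yx] := leP x y.
  by apply: key => //; rewrite distrC.
by rewrite distrC; apply: key => //; exact: ltW.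
Qed.

Lemma biconj_tradeoff : is_tradeoff (biconj M).
Proof.
split.
- exact: biconj_in01.
- exact: biconj_convex.
- apply/subspace_continuousP => x; rewrite /= in_itv/= => /andP[x0 x1].
  apply/cvgrPdist_lt => e e0.
  have [d d0 Hd] := biconj_eps_delta (in01I x0 x1) e0.
  exists d => //= y /= xy; rewrite in_itv/= => /andP[y0 y1].
  by apply: Hd.
- exact: biconj_nonincreasing.
- move=> x [x0 x1].
  have := biconj_convex in01_0 in01_1 (in01I (_ : 0 <= 1 - x) (_ : 1 - x <= 1)).
  rewrite biconj0 biconj1 mulr0 add0r mulr0 addr0 !mulr1 subKr; apply.
    by rewrite subr_ge0.
  by rewrite lerBlDr lerDl.
Qed.

End Biconjugate.

(** * The minimum of a function and its inverse *)

Section Symmetrization.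
Variables (R : realType) (f : R -> R).
Hypothesis f01 : forall x, in01 x -> in01 (f x).

Lemma tinv_le (a t : R) : in01 t -> f t <= a -> tinv f a <= t.
Proof.
move=> t01 fta; apply: ge_inf; last by left.
by exists 0 => z [[[]]//|->]; exact: ler01.
Qed.

(** The bound [c <= 1] accounts for the point 1 adjoined to the set in [tinv]. *)
Lemma tinv_ge (a c : R) : c <= 1 -> (forall t, in01 t -> f t <= a -> c <= t) ->
  c <= tinv f a.
Proof.
move=> c1 H; apply: lb_le_inf; first by exists 1; right.
by move=> z [[z01 fz]|->//]; exact: H.
Qed.

Definition tmin (a : R) : R := Num.min (f a) (tinv f a).

Lemma tmin_in01 (x : R) : in01 x -> in01 (tmin x).
Proof.
move=> x01; have [f0 f1] := f01 x01; split.
  by rewrite le_min f0/=; apply: tinv_ge => // t [].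
by rewrite ge_min f1.
Qed.

Lemma tmin1 : tmin 1 = 0.
Proof.
have [t0 _] := tmin_in01 (in01_1 R).
apply/eqP; rewrite eq_le t0 andbT ge_min; apply/orP; right.
by apply: tinv_le; [exact: in01_0|case: (f01 (in01_0 R))].
Qed.

(** The line with intercept b and slope -k reflects in the diagonal to (b - x) / k; it lies below
    the inverse once its reflection lies below [f]. *)
Lemma line_le_tmin (b k : R) : 0 < k ->
  (forall x, in01 x -> b - k * x <= f x) ->
  (forall x, in01 x -> (b - x) / k <= f x) ->
  forall x, in01 x -> b - k * x <= tmin x.
Proof.
move=> k0 Hf Hr x x01; rewrite le_min Hf//=.
have [x0 x1] := x01.
have b1 : b <= 1 by have := Hf _ (in01_0 R); have [] := f01 (in01_0 R); lra.
apply: tinv_ge; first by nra.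
move=> t t01 ftx; have := Hr _ t01; rewrite ler_pdivrMr//; nra.
Qed.

(** Evaluating the minorant at [f x], where the inverse is at most x, puts the reflected line below
    [f]. Reflecting again returns the original line, which is below [f] as well. *)
Lemma line_le_tmin_reflect (b k : R) : 0 < k ->
  (forall x, in01 x -> b - k * x <= tmin x) ->
  forall x, in01 x -> (b - x) / k <= tmin x.
Proof.
move=> k0 H.
have Hf x : in01 x -> b - k * x <= f x.
  by move=> /H; rewrite le_min => /andP[].
have Hr x : in01 x -> (b - x) / k <= f x.
  move=> x01; have := H _ (f01 x01); rewrite le_min => /andP[_ Hx].
  have := le_trans Hx (tinv_le x01 (lexx _)).
  by rewrite ler_pdivrMr//; lra.
move=> x x01; rewrite le_min Hr//=.
have [x0 x1] := x01.
have := H _ (in01_1 R); rewrite tmin1 => bk.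
apply: tinv_ge; first by rewrite ler_pdivrMr//; nra.
move=> t t01 ftx; have := Hf _ t01; rewrite ler_pdivrMr//; nra.
Qed.

(* Affine minorants of [tmin] are closed under reflection in the diagonal,
   hence so is the epigraph of the biconjugate. *)
Lemma biconj_tmin_swap (t a : R) : in01 t -> in01 a ->
  biconj tmin t <= a -> biconj tmin a <= t.
Proof.
move=> t01 a01 Fta; have [t0 t1] := t01; have [a0 a1] := a01.
(* A nonnegative slope contributes at most 0, since [tmin] vanishes at 1; a negative slope gives a
   minorant that can be reflected. *)
apply: biconj_le => y; have [y0|y0] := leP 0 y.
  by have := conj_ge tmin_in01 y (in01_1 R); rewrite tmin1; nra.
have k0 : 0 < - y by rewrite oppr_gt0.
have Hl x : in01 x -> - conj tmin y - (- y) * x <= tmin x.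
  by move=> x01; have := conj_ge tmin_in01 y x01; lra.
have Hr := line_le_tmin_reflect k0 Hl.
have : - conj tmin y / (- y) - (- y)^-1 * t <= biconj tmin t.
  by apply: (biconj_ge_line tmin_in01 t01) => x x01; have := Hr x x01; lra.
move=> /le_trans/(_ Fta); rewrite (_ : _ - _ = (- conj tmin y - t) / (- y)); last by lra.
by rewrite ler_pdivrMr//; lra.
Qed.

(** By the swap, the value at a belongs to the set in [tinv] and is a lower bound of it. *)
Lemma biconj_tmin_symmetric : tsymmetric (biconj tmin).
Proof.
move=> a a01; have Fa01 := biconj_in01 tmin_in01 a01.
apply/eqP; rewrite eq_le; apply/andP; split.
  apply: ge_inf; last by left; split => //; exact: biconj_tmin_swap a01 Fa01 (lexx _).
  by exists 0 => z [[[]]//|->]; exact: ler01.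
apply: lb_le_inf; first by exists 1; right.
by move=> z [[z01 Fz]|->]; [exact: biconj_tmin_swap | case: Fa01].
Qed.

End Symmetrization.

(** * The envelope of the mixed Gaussian trade-off function *)

Section RealDerivative.
Variable R : realType.
Implicit Types (f g : R -> R) (x a b c : R).

Lemma is_derive1_cst c x : is_derive x (1 : R) (fun=> c) 0.
Proof. exact: is_derive_cst. Qed.

Lemma is_derive1D f g x a b : is_derive x (1 : R) f a -> is_derive x (1 : R) g b ->
  is_derive x (1 : R) (fun y => f y + g y) (a + b).
Proof. exact: is_deriveD. Qed.

Lemma is_derive1Z c f x a : is_derive x (1 : R) f a ->
  is_derive x (1 : R) (fun y => c * f y) (c * a).
Proof. exact: is_deriveZ. Qed.

Lemma is_derive1M f g x a b : is_derive x (1 : R) f a -> is_derive x (1 : R) g b ->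
  is_derive x (1 : R) (fun y => f y * g y) (f x * b + g x * a).
Proof. exact: is_deriveM. Qed.

Lemma is_derive1_affine c a x : is_derive x (1 : R) (fun y => c * y + a) c.
Proof.
have := is_derive1D (is_derive1Z c (is_derive_id x (1 : R))) (is_derive1_cst a x).
by rewrite mulr1 addr0.
Qed.

Lemma is_derive_Phi_affine c a x :
  is_derive x (1 : R) (fun y => Phi (c * y + a)) (normal_pdf 0 1 (c * x + a) * c).
Proof.
exact: (@is_derive1_comp R (@Phi R) (fun y => c * y + a) x _ _
  (is_derive_Phi _) (is_derive1_affine c a x)).
Qed.

Lemma is_derive_expR_scale c x :
  is_derive x (1 : R) (fun y => expR (c * y)) (expR (c * x) * c).
Proof.
have := is_derive1_affine c 0 x; rewrite (_ : (fun _ => _) = *%R c); last first.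
  by apply/funext => y; rewrite addr0.
exact: (@is_derive1_comp R expR ( *%R c) x _ _ (is_derive_expR _)).
Qed.

End RealDerivative.

(** * The Gaussian trade-off function and its tangents *)

Section GaussianTradeoff.
Variables (R : realType) (mu : R).
Hypothesis mu_gt0 : 0 < mu.

(** Parametrization by thresholds: the test that rejects above x has errors [1 - Phi x] and
    [Phi (x - mu)]. *)
Lemma G_Phi (x : R) : G mu (1 - Phi x) = Phi (x - mu).
Proof.
rewrite /G leNgt subr_gt0 Phi_lt1/= lerBrDr gerDl leNgt Phi_gt0/=.
by rewrite subKr PhiinvK.
Qed.

Lemma G0 : G mu 0 = 1 :> R.
Proof. by rewrite /G lexx. Qed.

Lemma G1 : G mu 1 = 0 :> R.
Proof. by rewrite /G ler10 lexx. Qed.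

Lemma in01_PhiP (a : R) : in01 a -> [\/ a = 0, a = 1 | exists x, a = 1 - Phi x].
Proof.
move=> [a0 a1]; have [->|an0] := eqVneq a 0; first exact: Or31.
have [->|an1] := eqVneq a 1; first exact: Or32.
have a0' : 0 < a by rewrite lt_neqAle eq_sym an0.
have a1' : a < 1 by rewrite lt_neqAle an1.
have p0 : 0 < 1 - a by rewrite subr_gt0.
have p1 : 1 - a < 1 by rewrite ltrBlDr ltrDl.
have [x xE] := Phi_onto p0 p1; apply: Or33; exists x.
by rewrite xE subKr.
Qed.

Lemma G_in01 (a : R) : in01 a -> in01 (G mu a).
Proof.
move=> /in01_PhiP[->|->|[x ->]]; rewrite ?G0 ?G1 ?G_Phi.
- exact: in01_1.
- exact: in01_0.
- by split; [exact: Phi_ge0|exact: Phi_le1].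
Qed.

(** Replacing the threshold x by mu - x exchanges the two errors. *)
Lemma GK (a : R) : in01 a -> G mu (G mu a) = a.
Proof.
move=> /in01_PhiP[->|->|[x ->]]; rewrite ?G0 ?G1 ?G0//.
rewrite G_Phi -[x - mu]opprK PhiN G_Phi opprB addrAC subrr add0r.
exact: PhiN.
Qed.

Lemma normal_pdf_shift (x : R) :
  normal_pdf 0 1 (x - mu) = normal_pdf 0 1 x * expR (mu * x - mu ^+ 2 / 2).
Proof.
rewrite !normal_pdfE ?oner_neq0// /normal_fun -mulrA -expRD.
by congr (_ * expR _); field.
Qed.

(* Neyman-Pearson: the threshold test at [x0] minimizes
   [Phi (x - mu) - k * Phi x], since the likelihood ratio is increasing. *)
Lemma Phi_neyman_pearson (x0 x k : R) : k = expR (mu * x0 - mu ^+ 2 / 2) ->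
  Phi (x0 - mu) - k * Phi x0 <= Phi (x - mu) - k * Phi x.
Proof.
move=> kE; pose H (y : R) := Phi (y - mu) - k * Phi y.
pose dH (y : R) := normal_pdf 0 1 y * (expR (mu * y - mu ^+ 2 / 2) - k).
have HdH (y : R) : is_derive y (1 : R) H (dH y).
  have d1 := is_derive_Phi_affine 1 (- mu) y.
  have d2 := is_derive1Z (- k) (is_derive_Phi y).
  have := is_derive1D d1 d2; rewrite (_ : (fun _ => _) = H); last first.
    by apply/funext => z; rewrite /H mul1r mulNr.
  rewrite mul1r mulr1 normal_pdf_shift (_ : _ + _ = dH y)//.
  by rewrite /dH; ring.
have pos (y : R) : 0 < normal_pdf 0 1 y := normal_pdf_gt0 y.
rewrite -/(H x0) -/(H x); have [xx0|x0x|->//] := ltgtP x x0.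
- have [c [_ cx0 E]] := MVT_derive HdH xx0.
  have : dH c <= 0.
    rewrite /dH kE; apply: mulr_ge0_le0; first exact: (ltW (pos c)).
    rewrite subr_le0 ltW// ltr_expR.
    by rewrite ltrD2r ltr_pM2l.
  by have := pos c; nra.
- have [c [x0c _ E]] := MVT_derive HdH x0x.
  have : 0 <= dH c.
    rewrite /dH kE; apply: mulr_ge0; first exact: ltW (pos c).
    rewrite subr_ge0 ltW// ltr_expR.
    by rewrite ltrD2r ltr_pM2l.
  by nra.
Qed.

(** The tangent at level [1 - Phi x0] has slope -k, with k the likelihood ratio at x0.
    Neyman-Pearson gives the bound at every threshold; at levels 0 and 1, which no threshold
    attains, it follows by taking thresholds far out. *)
Lemma G_tangent (x0 a k : R) : k = expR (mu * x0 - mu ^+ 2 / 2) -> in01 a ->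
  Phi (x0 - mu) + k * (1 - Phi x0) - k * a <= G mu a.
Proof.
move=> kE a01; have k0 : 0 < k by rewrite kE expR_gt0.
have NP x := Phi_neyman_pearson x kE.
case: (in01_PhiP a01) => [->|->|[x ->]]; rewrite ?G0 ?G1 ?G_Phi.
- rewrite leNgt; apply/negP => lt1.
  (* The assumed excess over 1, divided by k; a threshold whose upper tail is below e contradicts
     Neyman-Pearson. *)
  pose e := (Phi (x0 - mu) + k * (1 - Phi x0) - k * 0 - 1) / k.
  have ke : k * e = Phi (x0 - mu) + k * (1 - Phi x0) - k * 0 - 1.
    by rewrite /e mulrCA divff ?mulr1// gt_eqF.
  have e0 : 0 < e by rewrite /e divr_gt0// subr_gt0.
  have [x [_ Hx]] := Phi_small e0.
  have := NP (- x); have := Phi_le1 (- x - mu); nra.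
- rewrite leNgt; apply/negP => lt0.
  have [x [Hx _]] := Phi_small lt0.
  have := NP x; have := Phi_ge0 x.
  have : Phi (x - mu) <= Phi x by rewrite ler_Phi gerBl ltW.
  nra.
- by have := NP x; nra.
Qed.

Variable u : R.
Hypothesis u01 : in01 u.

Definition fhat (a : R) : R := u + (1 - u) * G mu a.

Lemma fhat_in01 (x : R) : in01 x -> in01 (fhat x).
Proof.
by move=> /G_in01[? ?]; case: u01 => ? ?; rewrite /fhat; split; nra.
Qed.

Hypothesis u_lt1 : u < 1.
Let v := 1 - u.
Let v0 : 0 < v. Proof. by rewrite subr_gt0. Qed.
Let v1 : v <= 1. Proof. by rewrite /v; case: u01; lra. Qed.

(** The threshold at which [fhat] has slope -1, that is, where 1 - u times the likelihood ratio
    equals 1. *)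
Definition tangency : R := mu / 2 - ln (1 - u) / mu.

(** An offset t from tangency multiplies the slope by exp (mu t), so offsets d and -d have
    reciprocal slopes, as lines reflected in the diagonal do. *)
Lemma tangency_slope (t : R) :
  v * expR (mu * (tangency + t) - mu ^+ 2 / 2) = expR (mu * t).
Proof.
rewrite (_ : mu * _ - _ = - ln v + mu * t); last first.
  by rewrite /tangency -/v; field; rewrite gt_eqF.
rewrite expRD expRN lnK ?posrE// mulrA divff ?mul1r// gt_eqF//.
Qed.

Lemma normal_pdf_tangency (t : R) :
  v * normal_pdf 0 1 (tangency + t - mu) = normal_pdf 0 1 (tangency + t) * expR (mu * t).
Proof. by rewrite normal_pdf_shift mulrCA tangency_slope. Qed.

(* The reflection in the diagonal of the tangent to [fhat] at [tangency + d]
   comes closest to [fhat] at [tangency - d]; the gap vanishes at [d = 0] and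
   is nondecreasing in [d], because the derivatives of the [Phi] terms cancel. *)
Lemma tangent_reflection_gap (d : R) : 0 <= d ->
  u + v * Phi (tangency + d - mu) + expR (mu * d) * (1 - Phi (tangency + d)) <=
  expR (mu * d) * (u + v * Phi (tangency - d - mu)) + (1 - Phi (tangency - d)).
Proof.
move=> d0.
(* [W] is the right side minus the left side at offset t; in [dW] only the derivative of the
   exponential factor survives. *)
pose W (t : R) := expR (mu * t) * (v * Phi (- 1 * t + (tangency - mu)) +
    Phi (1 * t + tangency) + (u - 1)) +
  (- Phi (- 1 * t + tangency) + - v * Phi (1 * t + (tangency - mu)) + (1 - u)).
pose dW (t : R) := mu * expR (mu * t) *
  (u + v * Phi (tangency - t - mu) - (1 - Phi (tangency + t))).
have HdW (t : R) : is_derive t (1 : R) W (dW t).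
  have h1 := is_derive_Phi_affine (- 1) (tangency - mu) t.
  have h2 := is_derive_Phi_affine 1 tangency t.
  have h3 := is_derive_Phi_affine (- 1) tangency t.
  have h4 := is_derive_Phi_affine 1 (tangency - mu) t.
  have h12 := is_derive1D (is_derive1D (is_derive1Z v h1) h2) (is_derive1_cst (u - 1) t).
  have h34 := is_derive1D (is_derive1D (is_derive1Z (- 1) h3) (is_derive1Z (- v) h4))
    (is_derive1_cst (1 - u) t).
  have := is_derive1D (is_derive1M (is_derive_expR_scale mu t) h12) h34.
  rewrite (_ : (fun _ => _) = W); last by apply/funext => z; rewrite /W !mulN1r.
  have E1 : - 1 * t + (tangency - mu) = tangency - t - mu by ring.
  have E2 : 1 * t + tangency = tangency + t by ring.
  have E3 : - 1 * t + tangency = tangency - t by ring.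
  have E4 : 1 * t + (tangency - mu) = tangency + t - mu by ring.
  rewrite E1 E2 E3 E4.
  (* The density identities at t and -t cancel the derivatives of the [Phi] terms in pairs. *)
  have N1 := normal_pdf_tangency t.
  have N2 := normal_pdf_tangency (- t).
  have ee : expR (mu * t) * expR (mu * - t) = 1.
    by rewrite -expRD mulrN subrr expR0.
  have N3 : expR (mu * t) * (v * normal_pdf 0 1 (tangency - t - mu)) =
      normal_pdf 0 1 (tangency - t) by rewrite N2 mulrCA ee mulr1.
  set D := (X in is_derive _ _ _ X); rewrite (_ : D = dW t)//.
  by rewrite /D /dW; lra.
have E0 : W 0 = 0.
  by rewrite /W !mulr0 expR0 !add0r; ring.
have Wd : 0 <= W d.
  move: d0; rewrite le_eqVlt => /predU1P[<-|d0]; first by rewrite E0.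
  have [c [c0 _]] := MVT_derive HdW d0; rewrite E0 !subr0 => ->.
  rewrite mulr_ge0 ?(ltW d0)// mulr_ge0//.
    by rewrite mulr_ge0 ?expR_ge0// ltW.
  (* Since ln (1 - u) <= 0, the tangency threshold is at least mu / 2, which orders the two
     arguments of [Phi]. *)
  have lnv : ln (1 - u) <= 0 by rewrite -/v -ln1 ler_ln ?posrE ?ltr01.
  have : 1 - Phi (tangency + c) <= Phi (tangency - c - mu).
    rewrite -PhiN ler_Phi /tangency.
    have : ln (1 - u) / mu <= 0 by rewrite mulr_le0_ge0// invr_ge0 ltW.
    lra.
  have := Phi_ge0 (tangency - c - mu); have := Phi_le1 (tangency - c - mu).
  have [u0 _] := u01; rewrite /v => ? ? ?; nra.
move: Wd; rewrite /W !mulN1r !mul1r.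
have -> : - d + (tangency - mu) = tangency - d - mu by ring.
have -> : d + (tangency - mu) = tangency + d - mu by ring.
by rewrite (addrC d) (addrC (- d)); lra.
Qed.

Lemma fhat_ge_tangent (d a : R) : 0 <= d -> in01 a ->
  u + v * Phi (tangency + d - mu) + expR (mu * d) * (1 - Phi (tangency + d)) -
  expR (mu * d) * a <= fhat a.
Proof.
move=> d0 a01; have := G_tangent (erefl (expR (mu * (tangency + d) - mu ^+ 2 / 2))) a01.
rewrite -tangency_slope /fhat -/v; set k := expR _.
rewrite -(ler_pM2l v0); lra.
Qed.

(** The reflected line is parallel to the tangent of [fhat] at offset -d, and
    [tangent_reflection_gap] places it below that tangent. *)
Lemma fhat_ge_tangent_reflection (d a : R) : 0 <= d -> in01 a ->
  (u + v * Phi (tangency + d - mu) + expR (mu * d) * (1 - Phi (tangency + d)) - a) /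
  expR (mu * d) <= fhat a.
Proof.
move=> d0 a01; have := G_tangent (erefl (expR (mu * (tangency - d) - mu ^+ 2 / 2))) a01.
have := tangent_reflection_gap d0; have := tangency_slope (- d).
rewrite /fhat -/v mulrN expRN; set k := expR (_ - _).
have e0 : 0 < expR (mu * d) := expR_gt0 _.
rewrite ler_pdivrMr//; set e := expR _ in e0 *.
move=> kE gap tang.
have ek : e * (v * k) = 1 by rewrite kE divff// gt_eqF.
set A := G mu a in tang *; set P1 := Phi (tangency - d - mu) in tang gap *.
have : e * v * (P1 + k * (1 - Phi (tangency - d)) - k * a) <= e * v * A.
  by rewrite ler_pM2l// mulr_gt0.
have -> : e * v * (P1 + k * (1 - Phi (tangency - d)) - k * a) =
  e * v * P1 + (e * (v * k)) * (1 - Phi (tangency - d) - a) by ring.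
by rewrite ek; lra.
Qed.

End GaussianTradeoff.

(** * The closed form of the symmetrized function *)

Section Envelope.
Variables (R : realType) (mu u : R).
Hypotheses (mu_gt0 : 0 < mu) (u01 : in01 u) (u_lt1 : u < 1).
Local Notation f := (fhat mu u).
Local Notation F := (biconj (tmin (fhat mu u))).
Local Notation xs := (tangency mu u).

Let v0 : 0 < 1 - u. Proof. by rewrite subr_gt0. Qed.
Let f01 := fhat_in01 mu u01.
Let M01 := tmin_in01 f01.

Lemma fhat_Phi (x : R) : f (1 - Phi x) = u + (1 - u) * Phi (x - mu).
Proof. by rewrite /fhat G_Phi. Qed.

Lemma in01_Phi (x : R) : in01 (1 - Phi x).
Proof. by rewrite -PhiN; split; [exact: Phi_ge0|exact: Phi_le1]. Qed.

Lemma tangent_le_tmin (d x : R) : 0 <= d -> in01 x ->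
  u + (1 - u) * Phi (xs + d - mu) + expR (mu * d) * (1 - Phi (xs + d)) -
  expR (mu * d) * x <= tmin f x.
Proof.
move=> d0; apply: line_le_tmin => //; first exact: expR_gt0.
  by move=> y y01; exact: fhat_ge_tangent.
by move=> y y01; exact: fhat_ge_tangent_reflection.
Qed.

(** The minorant [tangent_le_tmin] is evaluated at its own point of tangency. *)
Lemma biconj_ge_fhat (d : R) : 0 <= d -> f (1 - Phi (xs + d)) <= F (1 - Phi (xs + d)).
Proof.
move=> d0; have := biconj_ge_line M01 (in01_Phi (xs + d)) (fun x => tangent_le_tmin d0 (x:=x)).
by rewrite fhat_Phi; lra.
Qed.

(** The reflected tangent, evaluated at the mirror image of the point of tangency. *)
Lemma biconj_ge_fhat_inv (d : R) : 0 <= d ->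
  1 - Phi (xs + d) <= F (u + (1 - u) * Phi (xs + d - mu)).
Proof.
move=> d0; have a01 : in01 (u + (1 - u) * Phi (xs + d - mu)).
  by rewrite -fhat_Phi; apply: f01; exact: in01_Phi.
have e0 := expR_gt0 (mu * d).
have H := line_le_tmin_reflect f01 e0 (fun x => tangent_le_tmin d0 (x:=x)).
set b := u + _ + _ in H.
have H' x : in01 x -> b / expR (mu * d) - (expR (mu * d))^-1 * x <= tmin f x.
  by move=> /H; rewrite mulrBl (mulrC x).
have := biconj_ge_line M01 a01 H'.
rewrite (_ : b / _ - _ = 1 - Phi (xs + d))// /b.
by field; rewrite gt_eqF.
Qed.

(** No tangent touches at level 0, but the intercepts of tangents at large thresholds approach 1. *)
Lemma biconj_fhat0 : 1 <= F 0.
Proof.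
rewrite leNgt; apply/negP => F0.
have e0 : 0 < 1 - F 0 by rewrite subr_gt0.
have [x [_]] := Phi_small e0; rewrite subKr => Hx.
(* Large enough that [xs + d - mu] is at least [- x], and nonnegative so that the tangent is a
   minorant of [tmin]. *)
pose d := Num.max 0 (- x - xs + mu).
have d0 : 0 <= d by rewrite le_max lexx.
have := biconj_ge_line M01 (in01_0 R) (fun x => tangent_le_tmin d0 (x:=x)).
have : F 0 < Phi (xs + d - mu).
  apply: (lt_le_trans Hx); rewrite ler_Phi.
  have : - x - xs + mu <= d by rewrite le_max lexx orbT.
  lra.
have : 0 <= expR (mu * d) * (1 - Phi (xs + d)).
  by rewrite mulr_ge0 ?expR_ge0// subr_ge0 Phi_le1.
set E := expR _; set Q := 1 - Phi _; set P := Phi _; set A := F 0 in e0 *.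
have [u0 _] := u01; have := v0; nra.
Qed.

Lemma tinv_fhat_le (a : R) : u <= a -> a <= 1 -> tinv f a <= G mu ((a - u) / (1 - u)).
Proof.
move=> ua a1; have a01 : in01 ((a - u) / (1 - u)).
  by split; rewrite ?divr_ge0 ?subr_ge0 ?(ltW u_lt1)// ler_pdivrMr// mul1r lerB.
apply: tinv_le; first exact: G_in01.
rewrite /fhat GK// mulrC mulfVK ?gt_eqF//; lra.
Qed.

(** The graph of [fhat] has slope -1 at (beta0, beta1); the tangent there also passes through the
    mirror image (beta1, beta0). *)
Let beta0 := 1 - Phi xs.
Let beta1 := u + (1 - u) * Phi (xs - mu).

Definition envelope (a : R) : R :=
  if a <= beta0 then f a else if a <= beta1 then beta0 + beta1 - a
  else G mu ((a - u) / (1 - u)).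

Let beta0_01 : in01 beta0. Proof. exact: in01_Phi. Qed.

Let f_beta0 : f beta0 = beta1. Proof. exact: fhat_Phi. Qed.

Let beta1_01 : in01 beta1. Proof. by rewrite -f_beta0; exact: f01. Qed.

(** Stated for any convex q, as it serves both the biconjugate and h. The outer branches are the
    assumed bounds; convexity along the chord between the two mirror points gives the middle one. *)
Lemma convex_le_envelope (q : R -> R) :
  (forall x y t, in01 x -> in01 y -> in01 t ->
     q (t * x + (1 - t) * y) <= t * q x + (1 - t) * q y) ->
  fle q f -> fle q (tinv f) -> fle q envelope.
Proof.
move=> cq qf qt a a01; rewrite /envelope; case: (leP a beta0) => [_|b0a]; first exact: (qf _ a01).
case: (leP a beta1) => [ab1|b1a]; last first.
  apply: (le_trans (qt _ a01)); apply: tinv_fhat_le; last by case: a01.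
  have := Phi_ge0 (xs - mu); move: b1a; rewrite /beta1; have := v0; nra.
have q0 : q beta0 <= beta1 by rewrite -f_beta0; exact: (qf _ beta0_01).
have q1 : q beta1 <= beta0.
  by apply: (le_trans (qt _ beta1_01)); apply: tinv_le => //; rewrite f_beta0.
have b01 : 0 < beta1 - beta0 by lra.
pose t := (beta1 - a) / (beta1 - beta0).
have tb : t * (beta1 - beta0) = beta1 - a by rewrite /t mulfVK// gt_eqF.
have t01 : in01 t by split; rewrite /t ?divr_ge0 ?ler_pdivrMr//; lra.
have aE : a = t * beta0 + (1 - t) * beta1 by lra.
have := cq _ _ _ beta0_01 beta1_01 t01; rewrite -aE.
case: t01; nra.
Qed.

Lemma biconj_fhatE (a : R) : in01 a -> F a = envelope a.
Proof.
move=> a01; apply/eqP; rewrite eq_le; apply/andP; split.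
  apply: convex_le_envelope => //.
  - exact: biconj_convex.
  - move=> x x01; apply: (le_trans (biconj_le_self M01 x01)).
    by rewrite ge_min lexx.
  - move=> x x01; apply: (le_trans (biconj_le_self M01 x01)).
    by rewrite ge_min lexx orbT.
have [a0 a1] := a01.
rewrite /envelope; case: (leP a beta0) => [ab0|b0a].
  case: (in01_PhiP a01) => [aE|aE|[x aE]].
  - by rewrite aE /fhat G0 mulr1 subrKC; exact: biconj_fhat0.
  - have := Phi_gt0 xs; move: ab0; rewrite aE /beta0; lra.
  - have xsx : 0 <= x - xs.
      by rewrite subr_ge0 -ler_Phi; move: ab0; rewrite aE /beta0; lra.
    by have := biconj_ge_fhat xsx; rewrite subrKC -aE.
case: (leP a beta1) => [ab1|b1a].
  (* The tangent at offset 0 is the middle branch itself. *)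
  have := biconj_ge_line M01 a01 (fun x => tangent_le_tmin (lexx 0) (x:=x)).
  by rewrite mulr0 expR0 addr0 /beta0 /beta1; lra.
have ua : u < a.
  by have := Phi_gt0 (xs - mu); move: b1a; rewrite /beta1; have := v0; nra.
have a'01 : in01 ((a - u) / (1 - u)).
  by split; rewrite ?divr_ge0 ?subr_ge0 ?(ltW ua) ?(ltW u_lt1)// ler_pdivrMr// mul1r lerB.
have aE : a = u + (1 - u) * ((a - u) / (1 - u)) by field; rewrite gt_eqF.
case: (in01_PhiP a'01) => [a'E|a'E|[y a'E]].
- by move: aE; rewrite a'E; lra.
- rewrite a'E G1 (_ : a = 1); last by rewrite aE a'E; lra.
  by rewrite biconj1//; exact: tmin1.
rewrite a'E G_Phi; rewrite a'E -PhiN in aE.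
(* At this offset the reflected tangent touches exactly at level a. *)
have yx : 0 <= mu - y - xs.
  move: b1a; rewrite /beta1 [in X in _ < X]aE ltrD2l ltr_pM2l// ltr_Phi; lra.
have := biconj_ge_fhat_inv yx.
have -> : xs + (mu - y - xs) - mu = - y by ring.
rewrite -aE; have -> : xs + (mu - y - xs) = - (y - mu) by ring.
by rewrite PhiN subKr.
Qed.

End Envelope.

(** With x the tangency threshold and mu = cU / sigma, the two arguments of [Phi] in the formula are
    x and mu - x. *)
Lemma envelope_formula (R : realType) (cU sigma u a : R) : 0 < cU -> 0 < sigma ->
  envelope (cU / sigma) u a = fU_formula cU sigma u a.
Proof.
move=> c0 s0; rewrite /envelope /fU_formula /=.
have -> : cU / (2 * sigma) - sigma / cU * ln (1 - u) = tangency (cU / sigma) u.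
  by rewrite /tangency; field; rewrite !gt_eqF.
have -> : cU / (2 * sigma) + sigma / cU * ln (1 - u) =
    - (tangency (cU / sigma) u - cU / sigma).
  by rewrite /tangency; field; rewrite !gt_eqF.
by rewrite PhiN subKr.
Qed.

Lemma biconj_fhat_u1 (R : realType) (mu a : R) : in01 a ->
  1 - a <= biconj (tmin (fhat mu 1)) a.
Proof.
have f01 := fhat_in01 mu (in01_1 R).
move=> a01; rewrite -[a in X in X <= _]mul1r.
apply: (biconj_ge_line (tmin_in01 f01)) => //.
by apply: line_le_tmin => // x [x0 x1]; rewrite /fhat; lra.
Qed.

(** For u < 1, h is compared with the explicit envelope by convexity; for u = 1 the bound
    [h a <= 1 - a] suffices. *)
Lemma tradeoff_envelope (R : realType) (mu u : R) (h : R -> R) :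
  0 < mu -> in01 u -> is_tradeoff h -> fle h (fhat mu u) -> fle h (tinv (fhat mu u)) ->
  let F := biconj (tmin (fhat mu u)) in
  [/\ fle h F, fle F (fhat mu u), is_tradeoff F, tsymmetric F &
      (u < 1 -> forall a, in01 a -> F a = envelope mu u a)].
Proof.
move=> mu0 u01 [_ hconv _ _ hle] hf hinv F.
have f01 := fhat_in01 mu u01; have M01 := tmin_in01 f01.
have FE : u < 1 -> forall a, in01 a -> F a = envelope mu u a.
  by move=> u1 a a01; exact: biconj_fhatE.
have [u1|u1] := ltP u 1.
  split => //.
  - by move=> a a01; rewrite FE//; exact: convex_le_envelope.
  - move=> a a01; apply: (le_trans (biconj_le_self M01 a01)).
    by rewrite ge_min lexx.
  - apply: biconj_tradeoff => //; first exact: tmin1.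
    exact: biconj_fhat0.
  - exact: biconj_tmin_symmetric.
  - by move=> _; exact: FE.
have {}u1 : u = 1 by apply/eqP; rewrite eq_le u1 andbT; case: u01.
subst u; split => //.
- by move=> a a01; apply: le_trans (hle _ a01) _; exact: biconj_fhat_u1.
- move=> a a01; apply: (le_trans (biconj_le_self M01 a01)).
  by rewrite ge_min lexx.
- apply: biconj_tradeoff => //; first exact: tmin1.
  by have := biconj_fhat_u1 mu (in01_0 R); rewrite subr0.
- exact: biconj_tmin_symmetric.
Qed.

(** * Weighted sums of independent Gaussians *)

Section GaussianSum.
Variable R : realType.
Local Notation std := (normal_prob (0 : R) 1).
Local Open Scope ereal_scope.

(** The total mass is q because m will be a probability restricted to an event. Divided by q, the
    joint law of X and Z is a product measure, to which the convolution applies. *)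
Lemma normal_sum_law d (T : measurableType d) (m : {measure set T -> \bar R})
  (X Z : T -> R) (q s L : R) :
  measurable_fun setT X -> measurable_fun setT Z ->
  (0 <= q)%R -> (0 <= s)%R -> (0 <= L)%R ->
  (forall A B, measurable A -> measurable B ->
    m (X @^-1` A `&` Z @^-1` B) = q%:E * (std (affine 0 s @^-1` A) * std B)) ->
  forall A, measurable A -> m [set w | A (X w + L * Z w)%R] =
    q%:E * std (affine 0 (Num.sqrt (s ^+ 2 + L ^+ 2)) @^-1` A).
Proof.
move=> mX mZ q0 s0 L0 mXZ A mA.
pose S := [set p : measurableTypeR R * measurableTypeR R | A (p.1 + L * p.2)%R].
have mS : measurable S.
  rewrite -[S]setTI; apply: (_ : measurable_fun setT
    (fun p : measurableTypeR R * measurableTypeR R => (p.1 + L * p.2)%R)) => //.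
  by apply: measurable_funD => //; exact: measurable_funM.
have mXZ2 : measurable_fun setT (fun w => (X w, Z w) : measurableTypeR R * measurableTypeR R).
  exact: measurable_fun_pair.
have maff A' : measurable A' -> measurable (affine 0 s @^-1` A').
  by move=> mA'; rewrite -[X in measurable X]setTI; exact: measurable_affine.
pose nu := image_measure m mXZ2.
have nuE : m [set w | A (X w + L * Z w)%R] = nu S by [].
(* A null measure cannot be normalized; both sides are then 0. *)
have [q0'|q0'] := eqVneq q 0%R.
  rewrite q0' mul0e nuE; apply/eqP; rewrite eq_le measure_ge0 andbT.
  apply: (@le_trans _ _ (nu setT)); first by rewrite le_measure ?inE.
  have := mXZ _ _ measurableT measurableT; rewrite q0' mul0e.
  by rewrite !preimage_setT setTI /nu /image_measure/= /pushforward preimage_setT => ->.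
have {q0'}q0 : (0 < q)%R by rewrite lt_neqAle eq_sym q0'.
have qV0 : (0 <= q^-1)%R by rewrite invr_ge0 ltW.
pose af : {mfun measurableTypeR R >-> measurableTypeR R} :=
  HB.pack (affine (0 : R) s) (isMeasurableFun.Build _ _ _ _ _ (measurable_affine (0 : R) s)).
pose lam : probability (measurableTypeR R) R := distribution std af.
have := @product_measure_unique _ _ _ _ R lam std (mscale (NngNum qV0) nu).
move=> /(_ _ _ mS) H.
rewrite nuE.
have -> : nu S = q%:E * mscale (NngNum qV0) nu S.
  by rewrite /mscale/= muleA -EFinM divff ?gt_eqF// mul1e.
rewrite -H; last first.
  move=> A' B mA' mB.
  transitivity ((q^-1)%:E * m (X @^-1` A' `&` Z @^-1` B)); first by [].
  by rewrite mXZ// muleA -EFinM mulVf ?gt_eqF// mul1e.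
congr (_ * _); rewrite -normal_prob_convolution//.
rewrite /product_measure1/= /lam ge0_integral_pushforward//=.
- apply: eq_integral => x _; congr (normal_prob _ _ _); apply/seteqP; split => z;
  by rewrite /xsection /affine/= inE/= add0r.
- exact: measurable_affine.
- exact: (measurable_fun_xsection std mS).
Qed.

(** Induction on the summed coordinates. Events for the coordinates not yet summed are carried
    along, so that the next one is still independent of the partial sum. *)
Lemma normal_weighted_sum_law d (T : measurableType d) (m : {measure set T -> \bar R})
  (K : finType) (Z : K -> T -> R) (q : R) (L : K -> R) :
  (forall k, measurable_fun setT (Z k)) -> (0 <= q)%R -> (forall k, 0 <= L k)%R ->
  (forall Bs : K -> set R, (forall k, measurable (Bs k)) ->
    m [set w | forall k, Bs k (Z k w)] = q%:E * \prod_k std (Bs k)) ->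
  forall (s : seq K), uniq s ->
  forall (A : set R) (Bs : K -> set R), measurable A -> (forall k, measurable (Bs k)) ->
  m [set w | A (\sum_(k <- s) L k * Z k w)%R /\ forall k, k \notin s -> Bs k (Z k w)] =
  q%:E * (std (affine 0 (Num.sqrt (\sum_(k <- s) L k ^+ 2)) @^-1` A) *
          \prod_(k | k \notin s) std (Bs k)).
Proof.
move=> mZ q0 L0 H; elim=> [_|k s IH /= /andP[ks us]] A Bs mA mBs.
  rewrite !big_nil sqrtr0.
  have [A0|A0] := pselect (A 0%R).
    rewrite (_ : _ @^-1` _ = setT); last first.
      by apply/seteqP; split => // z _; rewrite /affine/= add0r mul0r.
    rewrite probability_setT mul1e -H//; congr (m _); apply/seteqP; split => w /=.
      by move=> [_ Bw] k; apply: Bw.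
    by move=> Bw; split; rewrite ?big_nil// => k _; exact: Bw.
  rewrite (_ : _ @^-1` _ = set0); last first.
    by apply/seteqP; split => // z; rewrite /affine/= add0r mul0r.
  rewrite measure0 mul0e mule0 (_ : [set _ | _] = set0) ?measure0//.
  by apply/seteqP; split => // w /=; rewrite big_nil => -[].
(* Restricting m to the event for the remaining coordinates reduces the step to two variables, with
   total mass q p. *)
pose Ev := [set w | forall j, j \notin k :: s -> Bs j (Z j w)].
have mEv : measurable Ev.
  rewrite (_ : Ev = \bigcap_(j in [set j | j \notin k :: s]) Z j @^-1` Bs j)//.
  apply: fin_bigcap_measurable => [|j _]; first exact: finite_finset.
  by rewrite -[X in measurable X]setTI; exact: mZ.
pose X w := (\sum_(j <- s) L j * Z j w)%R.
have mX : measurable_fun setT X.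
  by apply: measurable_sum => j; exact: measurable_funM.
pose p := fine (\prod_(j | j \notin k :: s) std (Bs j)).
have pE : p%:E = \prod_(j | j \notin k :: s) std (Bs j).
  rewrite /p fineK// prode_fin_num// => j _; exact: fin_num_std.
have p0 : (0 <= p)%R.
  by rewrite -lee_fin pE; apply: prode_ge0 => j _; exact: measure_ge0.
have [s0 sq0] : (0 <= Num.sqrt (\sum_(j <- s) L j ^+ 2) /\ 0 <= \sum_(j <- s) L j ^+ 2)%R.
  by split; rewrite ?sqrtr_ge0// sumr_ge0// => j _; exact: sqr_ge0.
have := @normal_sum_law _ _ (mrestr m mEv) X (Z k) (q * p) _ (L k) mX (mZ k)
  (mulr_ge0 q0 p0) s0 (L0 k).
move=> /(_ _ _ mA) H'.
transitivity (mrestr m mEv [set w | A (X w + L k * Z k w)%R]).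
  rewrite /mrestr; congr (m _); apply/seteqP.
  by split => w /=; rewrite big_cons addrC.
rewrite H'; last first.
  (* For the induction hypothesis, coordinate k is still unsummed; its event there is B. *)
  move=> A' B mA' mB; pose Bs' j := if j == k then B else Bs j.
  have mBs' j : measurable (Bs' j) by rewrite /Bs'; case: ifP.
  transitivity (m [set w | A' (X w) /\ forall j, j \notin s -> Bs' j (Z j w)]).
    rewrite /mrestr; congr (m _); apply/seteqP; split => w /=.
      move=> [[A'w Bw] Ew]; split => // j js; rewrite /Bs'; case: eqVneq => [->//|jk].
      by apply: Ew; rewrite inE negb_or jk.
    move=> [A'w Bw]; split.
      by split=> //; have := Bw _ ks; rewrite /Bs' eqxx.
    move=> j; rewrite inE negb_or => /andP[jk js].
    by have := Bw _ js; rewrite /Bs' (negbTE jk).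
  rewrite (IH us _ _ mA' mBs') (bigD1 k)//= {1}/Bs' eqxx EFinM pE.
  rewrite (eq_big (fun j => j \notin k :: s) (fun j => std (Bs j))); last 2 first.
  - by move=> j; rewrite inE negb_or andbC.
  - by move=> j /andP[_ jk]; rewrite /Bs' (negbTE jk).
  by rewrite -!muleA; congr (_ * _); rewrite [RHS]muleC !muleA.
rewrite sqr_sqrtr// EFinM pE big_cons (addrC (L k ^+ 2)%R) -!muleA; congr (_ * _).
by rewrite muleC.
Qed.

End GaussianSum.

(** * The distinguishing mechanism *)

(** Row-major order: it locates round (e, b) at position [e * B + b] of the run. *)
Lemma nth_allpairs_pair (S T : Type) (x0 : S) (y0 : T) (s : seq S) (t : seq T) (i j : nat) :
  (i < size s)%N -> (j < size t)%N ->
  nth (x0, y0) [seq (x, y) | x <- s, y <- t] (i * size t + j) = (nth x0 s i, nth y0 t j).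
Proof.
elim: s i => // x s IH [|i] /= si tj; rewrite nth_cat size_map.
  by rewrite mul0n add0n tj (nth_map y0).
by rewrite mulSn -addnA ltnNge leq_addr/= addKn IH.
Qed.

Lemma mem_bool_set (T : Type) (P : T -> bool) (x : T) : (x \in [set y | P y]) = P x.
Proof. by apply/idP/idP; rewrite in_setE. Qed.

Section Mechanism.
Variables (R : realType) (N E B m D : nat) (Xi : Type) (C sigma : R).
Local Notation vec := (D.-tuple R).

Lemma tnth_sum_vadd (I : Type) (r : seq I) (F : I -> vec) (k : 'I_D) :
  tnth (\big[@vadd R D/v0 R D]_(h <- r) F h) k = \sum_(h <- r) tnth (F h) k.
Proof.
apply: (big_morph (fun v : vec => tnth v k)) => [x y|]; first by rewrite tnth_mktuple.
by rewrite tnth_mktuple.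
Qed.

Section FixedUpdate.
Variables (A : vec -> seq Xi -> vec) (d : 'I_N -> Xi) (i : Inst N E B m).
Variables (eta : 'I_E -> 'I_B -> R) (ow : 'I_E -> 'I_B -> option vec).
Hypothesis A_cst : forall w w' xs, A w xs = A w' xs.

Lemma round_step_cst e b z w w' :
  (round_step C sigma A d i eta ow e b z w).2 = (round_step C sigma A d i eta ow e b z w').2.
Proof.
rewrite /round_step /=; congr (vscale _ (vadd _ _)).
by apply: eq_bigr => h _; congr clip; exact: A_cst.
Qed.

(** When the update ignores the model, rounds do not influence each other, so any model w' may be
    used to compute the released values. *)
Lemma run_cst z rs w w' : run C sigma A d i eta ow z rs w =
  [seq (round_step C sigma A d i eta ow r.1 r.2 (z r.1 r.2) w').2 | r <- rs].
Proof.
by elim: rs w => //= r rs IH w; rewrite IH; congr (_ :: _); exact: round_step_cst.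
Qed.

Lemma tnth_released w0 z e b :
  tnth (tnth (released C sigma A w0 eta ow d i z) e) b =
  (round_step C sigma A d i eta ow e b (z e b) w0).2.
Proof.
rewrite !tnth_mktuple (run_cst _ _ _ w0) /rounds.
have se : size (enum 'I_E) = E by rewrite size_enum_ord.
have sb : size (enum 'I_B) = B by rewrite size_enum_ord.
rewrite (nth_map (e, b)); last first.
  rewrite size_allpairs se sb (@leq_trans (e * B + B))%N// ?ltn_add2l//.
  by rewrite addnC -mulSn leq_mul2r ltn_ord orbT.
have := @nth_allpairs_pair _ _ e b (enum 'I_E) (enum 'I_B) e b.
rewrite se sb => -> //.
by rewrite !nth_ord_enum.
Qed.

End FixedUpdate.

Variables (k0 : 'I_D) (xi0 xi1 : Xi).

Definition vec1 (c : R) : vec := [tuple if k == k0 then c else 0 | k < D].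

Lemma clip_vec1 (c : R) : 0 < C -> `|c| = C -> clip C (vec1 c) = vec1 c.
Proof.
move=> C0 cC; rewrite /clip.
have -> : vnorm (vec1 c) = C.
  rewrite /vnorm (bigD1 k0)//= tnth_mktuple eqxx big1 => [|k kk0].
    by rewrite addr0 sqrtr_sqr.
  by rewrite tnth_mktuple (negbTE kk0) expr0n.
rewrite divff ?gt_eqF// maxxx invr1; apply: eq_from_tnth => k.
by rewrite tnth_mktuple mul1r.
Qed.

(** The two answers are opposite vectors of norm C, as far apart as clipping allows. *)
Definition detect (w : vec) (xs : seq Xi) : vec :=
  vec1 (if has (fun x => `[< x = xi1 >]) xs then C else - C).

Definition marked (g : nat) (j : 'I_N) : Xi := if (j < g)%N then xi1 else xi0.

(** If c subsets fire, the clipped sum is C (2 c - m) and the noise is 2 C sigma z; undoing the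
    affine map leaves c + sigma z. *)
Lemma tnth_released_detect (g : nat) (i : Inst N E B m) eta ow w0 (d : 'I_N -> Xi) z e b :
  0 < C -> (0 < m)%N ->
  (m%:R * tnth (tnth (tnth (released C sigma detect w0 eta ow d i z) e) b) k0 +
   C * m%:R) / (2 * C) =
  #|[set h : 'I_m | has (fun x => `[< x = xi1 >])
       [seq d (iperm i e j) | j <- enum (iset i e b h)]]|%:R + sigma * z e b k0.
Proof.
move=> C0 m0; rewrite tnth_released//= !tnth_mktuple tnth_sum_vadd.
have mn0 : (m%:R : R) != 0 by rewrite pnatr_eq0 -lt0n.
rewrite (eq_bigr (fun h : 'I_m => - C + 2 * C *
   (has (fun x => `[< x = xi1 >]) [seq d (iperm i e j) | j <- enum (iset i e b h)])%:R)); last first.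
  move=> h _; rewrite clip_vec1//; last by case: ifP => _; rewrite ?normrN gtr0_norm.
  by rewrite tnth_mktuple eqxx; case: ifP => _; rewrite ?mulr1 ?mulr0; ring.
rewrite big_split/= sumr_const card_ord -mulr_sumr.
set S := \sum_h _; set c := #|_|.
have -> : S = c%:R.
  rewrite /S -natr_sum /c -sum1_card [in RHS]big_mkcond/=; congr (_%:R).
  by apply: eq_bigr => h _; rewrite mem_bool_set; case: has.
rewrite -mulr_natl; field.
by rewrite mn0 gt_eqF.
Qed.

Lemma has_marked (g : nat) (i : Inst N E B m) e b h : xi0 <> xi1 ->
  has (fun x => `[< x = xi1 >]) [seq marked g (iperm i e j) | j <- enum (iset i e b h)] =
  [exists j in iset i e b h, (iperm i e j < g)%N].
Proof.
move=> x01; rewrite has_map; apply/hasP/existsP => [[j]|[j /andP[jS jg]]].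
  rewrite mem_enum => jS /= /asboolP; rewrite /marked; case: ifP => [jg _|_ /x01//].
  by exists j; rewrite jS.
by exists j; rewrite ?mem_enum//=; apply/asboolP; rewrite /marked jg.
Qed.

Lemma has_unmarked (i : Inst N E B m) e b h : xi0 <> xi1 ->
  has (fun x => `[< x = xi1 >]) [seq (fun=> xi0) (iperm i e j) | j <- enum (iset i e b h)] =
  false.
Proof.
by move=> x01; rewrite has_map; apply/hasP => -[j _ /= /asboolP].
Qed.

(* Only an inequality is needed: [csq] ignores rounds with [Lbe > g], which
   disjointness of the subsets rules out anyway. *)
Lemma csq_le (g : nat) (i : Inst N E B m) :
  (csq g i <= \sum_(r : 'I_E * 'I_B) Lbe g i r.1 r.2 ^ 2)%N.
Proof.
rewrite /csq.
have -> : (\sum_(1 <= k < g.+1) ck g i k * k ^ 2 =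
   \sum_(1 <= k < g.+1) \sum_(r : 'I_B * 'I_E) (Lbe g i r.2 r.1 == k) * k ^ 2)%N.
  apply: eq_bigr => k _; rewrite -big_distrl/=; congr (_ * _)%N.
  by rewrite /ck -sum1_card big_mkcond/=; apply: eq_bigr => r _; rewrite mem_bool_set; case: eqP.
rewrite exchange_big/=.
rewrite [leqRHS](reindex (fun r : 'I_B * 'I_E => (r.2, r.1)))/=; last first.
  by exists (fun r => (r.2, r.1)) => -[].
apply: leq_sum => -[b e] _ /=; set l := Lbe g i e b.
have [lg|lg] := boolP (l \in index_iota 1 g.+1).
  rewrite (bigD1_seq l)//= ?iota_uniq// eqxx mul1n big1 ?addn0// => k.
  by rewrite eq_sym => /negbTE ->.
rewrite big1_seq// => k /andP[_ kg]; case: eqP => // lk.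
by move: lg; rewrite lk kg.
Qed.

End Mechanism.

(** * The distinguishing test *)

Section FinitePartition.
Context d (T : measurableType d) (R : realType) (K : finType) (I : T -> K).
Hypothesis mI : forall i, measurable [set w | I w = i].
Local Open Scope ereal_scope.

(** As [I] takes finitely many values, it suffices to treat each of them separately. *)
Lemma measurable_fiberwise (S : K -> set T) : (forall i, measurable (S i)) ->
  measurable [set w | S (I w) w].
Proof.
move=> mS; rewrite (_ : [set _ | _] =
  \bigcup_(i in [set: K]) ([set w | I w = i] `&` S i)); last first.
  apply/seteqP; split => w /=; first by exists (I w).
  by move=> [i _ [<-]].
apply: fin_bigcup_measurable => [|i _]; first exact: finite_finset.
exact: measurableI.
Qed.

Lemma measure_fiberwise (m : {measure set T -> \bar R}) (A : set T) :
  measurable A -> m A = \sum_(i \in [set: K]) m ([set w | I w = i] `&` A).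
Proof.
move=> mA; rewrite -measure_fin_bigcup//.
- congr (m _); apply/seteqP; split => w /=; first by exists (I w).
  by move=> [i _ []].
- exact: finite_finset.
- by move=> i j _ _ [w [[<- _] [<- _]]].
- by move=> i _; exact: measurableI.
Qed.

Lemma le_measure_fiberwise (m1 m2 : {measure set T -> \bar R}) (A B : set T) :
  measurable A -> measurable B ->
  (forall i, m1 ([set w | I w = i] `&` A) <= m2 ([set w | I w = i] `&` B)) ->
  m1 A <= m2 B.
Proof.
move=> mA mB H; rewrite (measure_fiberwise m1 mA) (measure_fiberwise m2 mB).
by apply: lee_fsum => //; exact: finite_finset.
Qed.

End FinitePartition.

Lemma normal_prob_oy (R : realType) (y : R) :
  normal_prob (0 : R) 1 `]y, +oo[ = (1 - Phi y)%:E.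
Proof.
by rewrite -setCitvl probability_setC// EFinB /Phi fineK// fin_num_std.
Qed.

(** * The Gaussian shift test given the sampling instance *)

Section Experiment.
Variables (R : realType) (N E B m D g : nat) (sigma cU : R).
Context dO (Omega : measurableType dO) (P : probability Omega R).
Variables (I : Omega -> Inst N E B m) (Z : Omega -> 'I_E -> 'I_B -> 'I_D -> R).
Hypothesis mI : forall i, measurable [set w | I w = i].
Hypothesis mZ : forall e b k, measurable_fun setT (fun w => Z w e b k).
Hypothesis indep : forall i (Bs : 'I_E -> 'I_B -> 'I_D -> set R),
  (forall e b k, measurable (Bs e b k)) ->
  P [set w | I w = i /\ forall e b k, Bs e b k (Z w e b k)] =
  (P [set w | I w = i] *
   \prod_(e < E) \prod_(b < B) \prod_(k < D) normal_prob 0 1 (Bs e b k))%E.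
Variable k0 : 'I_D.

Definition signal (i : Inst N E B m) (r : 'I_E * 'I_B) : R := (Lbe g i r.1 r.2)%:R.

Definition signal_norm (i : Inst N E B m) : R := Num.sqrt (\sum_r signal i r ^+ 2).

Definition noise (i : Inst N E B m) (w : Omega) : R :=
  \sum_r signal i r * Z w r.1 r.2 k0.

Lemma sqr_signal_norm i : signal_norm i ^+ 2 = \sum_r signal i r ^+ 2.
Proof. by rewrite sqr_sqrtr// sumr_ge0// => r _; exact: sqr_ge0. Qed.

Lemma measurable_noise i : measurable_fun setT (noise i).
Proof. by apply: measurable_sum => r; exact: measurable_funM. Qed.

(** Given the instance the weights are constants, so the noise is a weighted sum of independent
    normals with standard deviation [signal_norm i]. *)
Lemma noise_law (i : Inst N E B m) (y : R) : 0 < signal_norm i ->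
  P ([set w | I w = i] `&` [set w | signal_norm i * y < noise i w]) =
  (P [set w | I w = i] * (1 - Phi y)%:E)%E.
Proof.
move=> c0.
have pE : P [set w | I w = i] = (fine (P [set w | I w = i]))%:E.
  by rewrite fineK// fin_num_measure.
have H (Bs : 'I_E * 'I_B -> set R) : (forall r, measurable (Bs r)) ->
    mrestr P (mI i) [set w | forall r, Bs r (Z w r.1 r.2 k0)] =
    ((fine (P [set w | I w = i]))%:E * \prod_r normal_prob 0 1 (Bs r))%E.
  (* Coordinates other than [k0] are left unconstrained. *)
  move=> mBs; pose Bs' e b k := if k == k0 then Bs (e, b) else setT.
  have mBs' e b k : measurable (Bs' e b k) by rewrite /Bs'; case: ifP.
  rewrite -pE; transitivity (P [set w | I w = i /\ forall e b k, Bs' e b k (Z w e b k)]).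
    rewrite /mrestr; congr (P _); apply/seteqP; split => w /=.
      move=> [Bw Iw]; split => // e b k; rewrite /Bs'.
      by case: eqVneq => [->|//]; exact: (Bw (e, b)).
    move=> [Iw Bw]; split => // -[e b] /=.
    by have := Bw e b k0; rewrite /Bs' eqxx.
  rewrite (indep i mBs'); congr (_ * _)%E.
  rewrite pair_bigA/=; apply: eq_bigr => -[e b] _ /=.
  rewrite (bigD1 k0)//= big1 ?mule1 => [|k kk0]; first by rewrite /Bs' eqxx.
  by rewrite /Bs' (negbTE kk0) probability_setT.
have mZ' (r : 'I_E * 'I_B) : measurable_fun setT (fun w => Z w r.1 r.2 k0) by exact: mZ.
have s0 r : 0 <= signal i r by rewrite ler0n.
have p0 : 0 <= fine (P [set w | I w = i]) by rewrite fine_ge0.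
have := normal_weighted_sum_law mZ' p0 s0 H (index_enum_uniq _).
move=> /(_ `]signal_norm i * y, +oo[%classic (fun=> setT)).
move=> /(_ (measurable_itv _) (fun=> measurableT)).
rewrite [X in (_ * (_ * X))%E]big1 ?mule1; last by move=> r _; exact: probability_setT.
rewrite (_ : affine _ _ @^-1` _ = `]y, +oo[%classic); last first.
  apply/seteqP; split => z; rewrite /affine /= add0r !in_itv/= !andbT.
    by rewrite ltr_pM2l.
  by rewrite ltr_pM2l.
rewrite normal_prob_oy -pE => <-; rewrite /mrestr setIC; congr (P (_ `&` _)).
by apply/seteqP; split => w /=; rewrite in_itv/= andbT; [|case].
Qed.

Definition strong (i : Inst N E B m) : bool := cU ^+ 2 <= (csq g i)%:R.

(** The threshold y may vary with the instance, because the shift under the alternative does. *)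
Definition rejection (y : Inst N E B m -> R) : set Omega :=
  [set w | strong (I w) /\ signal_norm (I w) * y (I w) < noise (I w) w].

Lemma measurable_rejection y : measurable (rejection y).
Proof.
apply: (@measurable_fiberwise _ _ _ I mI
  (fun i => [set w | strong i /\ signal_norm i * y i < noise i w])) => i.
case: (strong i); last first.
  by rewrite (_ : [set _ | _] = set0)//; apply/seteqP; split => // w [].
rewrite (_ : [set _ | _] = noise i @^-1` `]signal_norm i * y i, +oo[).
  by rewrite -[X in measurable X]setTI; exact: measurable_noise.
by apply/seteqP; split => w /=; rewrite in_itv/= andbT => // -[].
Qed.

Hypothesis cU_gt0 : 0 < cU.

Lemma signal_norm_ge i : strong i -> cU <= signal_norm i.
Proof.
move=> si; rewrite -(ger0_norm (ltW cU_gt0)) -sqrtr_sqr ler_wsqrtr//.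
apply: (le_trans si); rewrite (eq_bigr (fun r => (Lbe g i r.1 r.2 ^ 2)%:R)).
  by rewrite -natr_sum ler_nat; exact: csq_le.
by move=> r _; rewrite natrX.
Qed.

Lemma rejection_fiber i y : P ([set w | I w = i] `&` rejection y) =
  if strong i then (P [set w | I w = i] * (1 - Phi (y i))%:E)%E else 0%E.
Proof.
case: ifPn => [si|/negP nsi]; last first.
  rewrite (_ : _ `&` _ = set0) ?measure0//; apply/seteqP; split => // w [/= Iw [sw _]].
  by apply: nsi; rewrite -Iw.
rewrite -noise_law; last exact: lt_le_trans cU_gt0 (signal_norm_ge si).
congr (P _); apply/seteqP; split => w [] /= Iw.
  by rewrite -Iw => -[].
by move=> H; split => //; split; rewrite Iw.
Qed.

(** Fiber by fiber comparison of P with the measure p P. *)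
Lemma rejection_le (y : Inst N E B m -> R) (p : R) : (0 <= p) ->
  (forall i, strong i -> 1 - Phi (y i) <= p) -> (P (rejection y) <= p%:E)%E.
Proof.
move=> p0 yp.
apply: (@le_trans _ _ (mscale (NngNum p0) P setT)); last first.
  by rewrite /mscale/= probability_setT mule1.
apply: (@le_measure_fiberwise _ _ R _ I mI P (mscale (NngNum p0) P)) => // [|i].
  exact: measurable_rejection.
apply: (@eq_ind_r _ _ (fun z => (z <= _)%E) _ _ (rejection_fiber i y)).
rewrite /mscale/= setIT muleC.
case: ifP => [si|_]; last by rewrite mule_ge0.
by apply: lee_wpmul2r => //; rewrite lee_fin yp.
Qed.

Lemma rejection_ge (y : Inst N E B m -> R) (p : R) : (0 <= p) ->
  (forall i, strong i -> p <= 1 - Phi (y i)) ->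
  (p%:E * P [set w | strong (I w)] <= P (rejection y))%E.
Proof.
move=> p0 yp.
have ms : measurable [set w | strong (I w)].
  apply: (@measurable_fiberwise _ _ _ I mI (fun i => [set w | strong i])) => i.
  case: (strong i); first by rewrite (_ : [set _ | _] = setT)//; apply/seteqP; split.
  by rewrite (_ : [set _ | _] = set0)//; apply/seteqP; split.
apply: (@le_measure_fiberwise _ _ R _ I mI (mscale (NngNum p0) P) P) => // [|i].
  exact: measurable_rejection.
apply: (@eq_ind_r _ _ (fun z => (_ <= z)%E) _ _ (rejection_fiber i y)).
rewrite /mscale/= muleC; case: ifPn => [si|/negP nsi].
  apply: lee_pmul => //; first by rewrite lee_fin yp.
  by rewrite le_measure ?inE//; exact: measurableI.
rewrite (_ : _ `&` _ = set0) ?measure0 ?mul0e//.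
by apply/seteqP; split => // w [/= Iw sw]; apply: nsi; rewrite -Iw.
Qed.

(** Finitely many disjoint events, one for each occurring value c < cU, cover the instances that are
    not strong; their masses form a finite partial sum of the [esum]. *)
Lemma strong_prob (u : R) :
  (\esum_(c in [set c | @Cset R g c /\ (c < cU)%R]) qE P I g c <= u%:E)%E ->
  ((1 - u)%:E <= P [set w | strong (I w)])%E.
Proof.
move=> Hu.
have ms (S : set (Inst N E B m)) : measurable [set w | S (I w)].
  apply: (@measurable_fiberwise _ _ _ I mI (fun i => [set w | S i])) => i.
  have [Si|Si] := pselect (S i).
    by rewrite (_ : [set _ | _] = setT)//; apply/seteqP; split.
  by rewrite (_ : [set _ | _] = set0)//; apply/seteqP; split.
pose cn (i : Inst N E B m) : R := Num.sqrt (csq g i)%:R.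
pose F := cn @` [set i | ~~ strong i].
have weak : (P [set w | ~~ strong (I w)] <= u%:E)%E.
  apply: le_trans Hu; apply: esum_ge; exists F.
    split; first by apply: finite_image; exact: finite_finset.
    move=> _ [i /= nsi <-]; split; first by exists (ck g i).
    rewrite -(ger0_norm (ltW cU_gt0)) -sqrtr_sqr ltr_sqrt ?exprn_gt0//.
    by rewrite ltNge.
  rewrite /qE -measure_fin_bigcup//.
  - rewrite le_measure ?inE//.
    + exact: (ms [set i | ~~ strong i]).
    + apply: fin_bigcup_measurable; first by apply: finite_image; exact: finite_finset.
      by move=> c _; exact: (ms [set i | c ^+ 2 = (csq g i)%:R]).
    + move=> w nsw; exists (cn (I w)); first by exists (I w).
      by rewrite /= sqr_sqrtr.
  - by apply: finite_image; exact: finite_finset.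
  - move=> _ _ [i _ <-] [j _ <-] [w []] /=; rewrite /cn !sqr_sqrtr//.
    by move=> -> <-.
  - by move=> c _; exact: (ms [set i | c ^+ 2 = (csq g i)%:R]).
have := probability_setC P (ms [set i | ~~ strong i]).
rewrite (_ : ~` _ = [set w | strong (I w)]); last first.
  by apply/seteqP; split => w /=; [move/negP/negPn|move=> ->].
move=> ->; rewrite EFinB leeB//.
Qed.

End Experiment.

(** The indicator of S is an admissible test at level a whose error is at most b. *)
Lemma tradeoffT_le (R : realType) dO (Omega : measurableType dO) (P : probability Omega R)
  dV (V : measurableType dV) (X Y : Omega -> V) (S : set V) (a b : R) :
  measurable S -> measurable (X @^-1` S) -> measurable (Y @^-1` S) -> 0 <= b ->
  (P (X @^-1` S) <= a%:E)%E -> ((1 - b)%:E <= P (Y @^-1` S))%E ->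
  tradeoffT P X Y a <= b.
Proof.
move=> mS mX mY b0 Xa Yb; rewrite /tradeoffT; set W := [set _ | _ in _].
have PE (Q : Omega -> V) : measurable (Q @^-1` S) ->
    (\int[P]_w (\1_S (Q w))%:E = P (Q @^-1` S))%E.
  by move=> mQ; rewrite (_ : (fun _ => _) = (fun w => (\1_(Q @^-1` S) w)%:E))
    ?integral_indic ?setIT//.
(* [inf] is 0 on sets that are not bounded below. *)
have [|/inf_out->//] := pselect (has_inf W).
move=> [_ lbW]; apply: (@le_trans _ _ (1 - fine (P (Y @^-1` S)))).
  apply: ge_inf => //; exists \1_S; last by rewrite PE.
  split=> [|v|]; first exact: measurable_indic.
    by rewrite indicE; case: (_ \in _); rewrite ?ler01 ?lexx.
  by rewrite PE// -lee_fin fineK// fin_num_measure.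
have : 1 - b <= fine (P (Y @^-1` S)) by rewrite -lee_fin fineK// fin_num_measure.
lra.
Qed.

(** * Tests between marked and unmarked data *)

Section Test.
Variables (R : realType) (g m E N B D : nat) (C sigma : R).
Variables (Xi : Type) (xi0 xi1 : Xi).
Context (dO : measure_display) (Omega : measurableType dO) (P : probability Omega R).
Variables (I : Omega -> Inst N E B m) (Z : Omega -> 'I_E -> 'I_B -> 'I_D -> R).
Variables (cU u : R) (k0 : 'I_D).
Hypotheses (m_gt0 : (0 < m)%N) (C_gt0 : 0 < C) (sigma_gt0 : 0 < sigma).
Hypotheses (cU_gt0 : 0 < cU) (xi01 : xi0 <> xi1).
Hypothesis mI : forall i, measurable [set w | I w = i].
Hypothesis mZ : forall e b k, measurable_fun setT (fun w => Z w e b k).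
Hypothesis indep : forall i (Bs : 'I_E -> 'I_B -> 'I_D -> set R),
  (forall e b k, measurable (Bs e b k)) ->
  P [set w | I w = i /\ forall e b k, Bs e b k (Z w e b k)] =
  (P [set w | I w = i] *
   \prod_(e < E) \prod_(b < B) \prod_(k < D) normal_prob 0 1 (Bs e b k))%E.
Hypothesis small_prob :
  (\esum_(c in [set c | @Cset R g c /\ (c < cU)%R]) qE P I g c <= u%:E)%E.

Definition view (d : 'I_N -> Xi) : Omega -> View N E B m R D :=
  mview C sigma (detect C k0 xi1) (v0 R D) (fun _ _ => 0) (fun _ _ => None) I Z d.

(* In each round the released coordinate is rescaled so that its mean counts
   the subsets in which [detect] fires, with noise [sigma * Z]. *)
Definition statistic (v : View N E B m R D) : R :=
  \sum_(r : 'I_E * 'I_B) signal R g v.1 r *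
    ((m%:R * tnth (tnth (tnth v.2 r.1) r.2) k0 + C * m%:R) / (2 * C)).

Definition critical (x : R) : set (View N E B m R D) :=
  [set v | strong g cU v.1 /\ sigma * (signal_norm R g v.1 * x) < statistic v].

Lemma measurable_critical x : measurable (critical x).
Proof.
apply: (@measurable_fiberwise _ _ _ (fun v : View N E B m R D => v.1 : Inst N E B m) _
  (fun i => [set v : View N E B m R D | strong g cU i /\
     sigma * (signal_norm R g i * x) < \sum_(r : 'I_E * 'I_B) signal R g i r *
    ((m%:R * tnth (tnth (tnth v.2 r.1) r.2) k0 + C * m%:R) / (2 * C))])) => i.
  have := @measurable_fst _ _ (discr (Inst N E B m)) (Out E B R D).
  by move=> /(_ measurableT [set (i : discr (Inst N E B m))]); rewrite setTI; apply.
case: (strong g cU i); last first.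
  by rewrite (_ : [set _ | _] = set0)//; apply/seteqP; split => // w [].
pose f (v : View N E B m R D) := \sum_(r : 'I_E * 'I_B) signal R g i r *
    ((m%:R * tnth (tnth (tnth v.2 r.1) r.2) k0 + C * m%:R) / (2 * C)).
have mf : measurable_fun setT f.
  apply: measurable_sum => r; apply: measurable_funM => //.
  apply: measurable_funM => //; apply: measurable_funD => //.
  apply: measurable_funM => //.
  apply: (measurableT_comp (measurable_tnth k0)).
  apply: (measurableT_comp (measurable_tnth r.2)).
  apply: (measurableT_comp (measurable_tnth r.1)).
  exact: measurable_snd.
rewrite (_ : [set _ | _] = f @^-1` `]sigma * (signal_norm R g i * x), +oo[).
  by rewrite -[X in measurable X]setTI; exact: mf.
by apply/seteqP; split => w /=; rewrite in_itv/= andbT => // -[].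
Qed.

Lemma statistic_view d w : statistic (view d w) =
  \sum_(r : 'I_E * 'I_B) signal R g (I w) r *
  (#|[set h : 'I_m | has (fun x => `[< x = xi1 >])
       [seq d (iperm (I w) r.1 j) | j <- enum (iset (I w) r.1 r.2 h)]]|%:R
    + sigma * Z w r.1 r.2 k0).
Proof.
apply: eq_bigr => r _; congr (_ * _).
exact: (@tnth_released_detect R N E B m D Xi C sigma k0 xi1 g).
Qed.

(** Without marked values no subset fires, and the statistic is sigma times the noise. *)
Lemma critical_null x : view (fun=> xi0) @^-1` critical x =
  rejection g cU I Z k0 (fun=> x).
Proof.
have statE w : statistic (view (fun=> xi0) w) = sigma * noise g Z k0 (I w) w.
  rewrite statistic_view /noise mulr_sumr; apply: eq_bigr => r _.
  rewrite eq_card0 => [|h]; first by rewrite add0r mulrCA.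
  by rewrite mem_bool_set has_unmarked.
have criticalE w : critical x (view (fun=> xi0) w) <-> rejection g cU I Z k0 (fun=> x) w.
  by rewrite /critical /rejection /mkset statE ltr_pM2l.
by apply/seteqP; split => w /criticalE.
Qed.

(** Each round counts [Lbe] firing subsets, so the statistic is shifted by the squared signal norm;
    this lowers the threshold by [signal_norm / sigma]. *)
Lemma critical_alt x : view (marked xi0 xi1 g) @^-1` critical x =
  rejection g cU I Z k0 (fun i => x - signal_norm R g i / sigma).
Proof.
have statE w : statistic (view (marked xi0 xi1 g) w) =
    signal_norm R g (I w) ^+ 2 + sigma * noise g Z k0 (I w) w.
  rewrite statistic_view sqr_signal_norm /noise mulr_sumr -big_split/=.
  apply: eq_bigr => r _.
  rewrite (_ : #|_| = Lbe g (I w) r.1 r.2); last first.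
    by apply: eq_card => h; rewrite !mem_bool_set has_marked.
  by rewrite mulrDr expr2 mulrCA.
have criticalE w : critical x (view (marked xi0 xi1 g) w) <->
    rejection g cU I Z k0 (fun i => x - signal_norm R g i / sigma) w.
  rewrite /critical /rejection /mkset statE -[_ < noise _ _ _ _ _](ltr_pM2l sigma_gt0).
  rewrite (_ : sigma * (_ * (x - _)) =
    sigma * (signal_norm R g (I w) * x) - signal_norm R g (I w) ^+ 2).
    by rewrite ltrBlDl.
  by field; rewrite gt_eqF.
by apply/seteqP; split => w /criticalE.
Qed.

(** The threshold x with [1 - Phi x = t] is used for all strong instances. On these the power is at
    least that at shift cU / sigma, and they have probability at least 1 - u; the product of the two
    bounds is [1 - fhat t]. *)
Lemma test_exists (t : R) : 0 < t -> t < 1 -> exists S : set (View N E B m R D),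
  [/\ measurable S, measurable (view (fun=> xi0) @^-1` S),
      measurable (view (marked xi0 xi1 g) @^-1` S),
      (P (view (fun=> xi0) @^-1` S) <= t%:E)%E &
      ((1 - fhat (cU / sigma) u t)%:E <= P (view (marked xi0 xi1 g) @^-1` S))%E].
Proof.
move=> t0 t1.
case: (in01_PhiP (in01I (ltW t0) (ltW t1))) => [tE|tE|[x tE]].
- by move: t0; rewrite tE ltxx.
- by move: t1; rewrite tE ltxx.
exists (critical x); rewrite critical_null critical_alt; split.
- exact: measurable_critical.
- exact: measurable_rejection.
- exact: measurable_rejection.
- by apply: rejection_le => //; [exact: ltW|move=> i _; rewrite tE].
rewrite /fhat tE G_Phi; set p := Phi _.
have p1 : 0 <= 1 - p by rewrite subr_ge0; exact: Phi_le1.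
apply: (@le_trans _ _ ((1 - p)%:E * P [set w | strong g cU (I w)])%E); last first.
  apply: rejection_ge => // i si; rewrite lerB// ler_Phi lerB//.
  by rewrite ler_pM2r ?invr_gt0//; exact: signal_norm_ge.
apply: (@le_trans _ _ ((1 - p)%:E * (1 - u)%:E)%E).
  by rewrite -EFinM lee_fin; lra.
by apply: lee_wpmul2l => //; exact: strong_prob.
Qed.

End Test.

(** * The bounds on h and the conclusion *)

Theorem theorem1 (R : realType) (g s m E N D : nat) (C sigma : R)
  (Xi : Type) (xi0 xi1 : Xi)
  (dO : measure_display) (Omega : measurableType dO)
  (P : probability Omega R)
  (I : Omega -> Inst N E (N %/ (m * s)) m)
  (Z : Omega -> 'I_E -> 'I_(N %/ (m * s)) -> 'I_D -> R)
  (cU u : R) (h : R -> R) :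
  (0 < g)%N -> (0 < s)%N -> (0 < m)%N -> (0 < E)%N -> (g <= N)%N ->
  (m * s %| N)%N -> 0 < C -> 0 < sigma ->
  (0 < D)%N -> xi0 <> xi1 ->
  (* the realized instance of the sampling procedure *)
  (forall i, measurable [set w | I w = i]) ->
  (forall w, sample_ok s (I w)) ->
  (forall p : 'I_E -> {perm 'I_N},
     P [set w | forall e, iperm (I w) e = p e] = ((N`!)%:R ^- E)%:E) ->
  (* i.i.d. standard normal noise, independent of the instance *)
  (forall e b k, measurable_fun setT (fun w => Z w e b k)) ->
  (forall i (Bs : 'I_E -> 'I_(N %/ (m * s)) -> 'I_D -> set R),
     (forall e b k, measurable (Bs e b k)) ->
     P [set w | I w = i /\ forall e b k, Bs e b k (Z w e b k)] =
     (P [set w | I w = i] *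
      \prod_(e < E) \prod_(b < N %/ (m * s)) \prod_(k < D)
         normal_prob 0 1 (Bs e b k))%E) ->
  0 < cU -> u <= 1 ->
  (\esum_(c in [set c | @Cset R g c /\ (c < cU)%R]) qE P I g c <= u%:E)%E ->
  is_tradeoff h ->
  (forall (A : D.-tuple R -> seq Xi -> D.-tuple R) (w0 : D.-tuple R)
          (eta : 'I_E -> 'I_(N %/ (m * s)) -> R)
          (ow : 'I_E -> 'I_(N %/ (m * s)) -> option (D.-tuple R)),
     (forall xs k, measurable_fun setT (fun w => tnth (A w xs) k)) ->
     forall d d' : 'I_N -> Xi, (forall j : 'I_N, (g <= j)%N -> d j = d' j) ->
     is_fDP P h (mview C sigma A w0 eta ow I Z d)
                (mview C sigma A w0 eta ow I Z d')) ->
  let fhat := fun a => u + (1 - u) * G (cU / sigma) a in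
  let fU := biconj (fun a => Num.min (fhat a) (tinv fhat a)) in
  [/\ fle h fU, fle fU fhat, is_tradeoff fU, tsymmetric fU &
      (u < 1 -> forall a, in01 a -> fU a = fU_formula cU sigma u a)].
Proof.
move=> _ s0 m0 _ _ _ C0 sigma0 D0 xi01 mI _ _ mZ indep cU0 u1 Hu htr hDP.
pose k0 := Ordinal D0.
have mu0 : 0 < cU / sigma by rewrite divr_gt0.
have u0 : 0 <= u.
  rewrite -lee_fin; apply: le_trans Hu; apply: esum_ge0 => c _; exact: measure_ge0.
have u01 : in01 u by [].
have [h01 _ _ _ hle] := htr.
have H := hDP (detect C k0 xi1) (v0 R D) (fun _ _ => 0) (fun _ _ => None).
have {}H d d' : (forall j : 'I_N, (g <= j)%N -> d j = d' j) ->
    fle h (tradeoffT P (view C sigma xi1 I Z k0 d) (view C sigma xi1 I Z k0 d')).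
  apply: H => xs k.
  exact: (measurable_cst (tnth (detect C k0 xi1 (v0 R D) xs) k)).
have dd' (j : 'I_N) : (g <= j)%N -> xi0 = marked xi0 xi1 g j.
  by rewrite /marked ltnNge => ->.
have test := test_exists k0 m0 C0 sigma0 cU0 xi01 mI mZ indep Hu.
(* Interior levels use the threshold test; at levels 0 and 1 the range of h and [h a <= 1 - a]
   suffice. *)
have hf : fle h (fhat (cU / sigma) u).
  move=> a a01; have [a0 a1] := a01.
  have [->|an0] := eqVneq a 0; first by rewrite /fhat G0 mulr1 subrKC; case: (h01 _ (in01_0 R)).
  have [->|an1] := eqVneq a 1.
    by have := hle _ (in01_1 R); rewrite /fhat G1 mulr0; lra.
  have a0' : 0 < a by rewrite lt_neqAle eq_sym an0.
  have a1' : a < 1 by rewrite lt_neqAle an1.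
  have [S [mS mX mY X Y]] := test a a0' a1'.
  apply: (le_trans (H _ _ dd' _ a01)).
  by apply: (tradeoffT_le mS mX mY _ X Y); case: (fhat_in01 (cU / sigma) u01 a01).
(* The pair is swapped and the test complemented: its level is at most [fhat t <= a], and its error
   at most t. *)
have hinv : fle h (tinv (fhat (cU / sigma) u)).
  move=> a a01; have [a0 a1] := a01; apply: tinv_ge; first by case: (h01 _ a01).
  move=> t t01 fta; have [t0 t1] := t01.
  have [tE|tn0] := eqVneq t 0.
    have := hle _ a01; move: fta; rewrite tE /fhat G0; lra.
  have [->|tn1] := eqVneq t 1; first by case: (h01 _ a01).
  have t0' : 0 < t by rewrite lt_neqAle eq_sym tn0.
  have t1' : t < 1 by rewrite lt_neqAle tn1.
  have [S [mS mX mY X Y]] := test t t0' t1'.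
  apply: (le_trans (H _ _ (fun j gj => esym (dd' j gj)) _ a01)).
  apply: (tradeoffT_le (measurableC mS)) => //.
  - by rewrite preimage_setC; exact: measurableC.
  - by rewrite preimage_setC; exact: measurableC.
  - rewrite preimage_setC probability_setC//; move: Y.
    by rewrite -(fineK (fin_num_measure P _ mY)) -EFinB !lee_fin; lra.
  - rewrite preimage_setC probability_setC//; move: X.
    by rewrite -(fineK (fin_num_measure P _ mX)) -EFinB !lee_fin; lra.
have [h1 h2 h3 h4 h5] := tradeoff_envelope mu0 u01 htr hf hinv.
by split => // u1' a a01; rewrite -envelope_formula//; exact: h5.
Qed.
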